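(* Let $l\ge4$ be even, $\mathfrak g=so(2l,\mathbf C)$, $\mathfrak h\subset\mathfrak g$ a Cartan subalgebra, $B$ the canonical invariant bilinear form, $\mathfrak s_0$ the principal $sl_2$-triple, and $\sigma$ the automorphism of $\mathfrak g$ of order two induced by the Dynkin diagram automorphism exchanging $\alpha_{l-1}$ and $\alpha_l$, with eigenspace decomposition $\mathfrak g=\mathfrak g_0\oplus\mathfrak g_1$ ($\sigma=+1$ on $\mathfrak g_0$ and $\sigma=-1$ on $\mathfrak g_1$). Consider the decomposition of $\mathfrak g$ into $\mathfrak s_0$-modules $$\mathfrak g=V_1\oplus\cdots\oplus V_{l/2-1}\oplus W\oplus V_{l/2+2}\oplus\cdots\oplus V_l,$$ where $W$ is the sum of the two irreducible $\mathfrak s_0$-modules of equal dimension $2l-1$ and the $V_i$ are the other irreducible $\mathfrak s_0$-modules. Then: (a) All the irreducible $\mathfrak s_0$-modules $V_i$ ($i\ne l/2,\,l/2+1$) are contained in $\mathfrak g_0$. (b) The $\mathfrak s_0$-module $W$ is invariant under $\sigma$, i.e. $\sigma(W)=W$. (c) The automorphism $\sigma$ provides a decomposition $W=W_0\oplus W_1$, where $W_i\subset\mathfrak g_i$. Moreover, this is a decomposition into two irreducible $\mathfrak s_0$-submodules, and they are orthogonal (with respect to $B$). Hence, if one requires that the elements of the principal basis of $\mathfrak h$ be eigenvectors of $\sigma$, then the principal basis is uniquely determined (up to constant multiples).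
   Context: Notation. $\alpha_1,\dots,\alpha_l$ are the simple roots of $\mathfrak g$ (type $D_l$), with $\alpha_{l-1},\alpha_l$ the two end nodes attached to $\alpha_{l-2}$. $B$ is the invariant form normalized by $B(\alpha_i,\alpha_i)=2$ on $\mathfrak h^*$. $e_i,f_i$ are root vectors for $\alpha_i,-\alpha_i$ with $B(e_i,f_i)=1$, and $\alpha_i^\vee$ are the simple coroots. The automorphism is $\sigma(\alpha_i)=\alpha_i$ for $i\le l-2$, $\sigma(\alpha_{l-1})=\alpha_l$, $\sigma(\alpha_l)=\alpha_{l-1}$; the induced Lie algebra automorphism, also denoted $\sigma$, permutes the $e_i$, the $f_i$ and the $\alpha_i^\vee$ in the same way. Principal $sl_2$-triple: $\mathfrak s_0=\langle e_0,f_0,h_0\rangle_{\mathbf C}$ with $h_0=2\rho^\vee$ (the sum of positive coroots), $e_0=\sum_ie_i$, and $f_0=\sum_ic_if_i$ where $h_0=\sum_ic_i\alpha_i^\vee$. Decomposition. The exponents of $\mathfrak g$, in increasing order $k_1\le\cdots\le k_l$, are $1,3,\dots,l-1,l-1,\dots,2l-5,2l-3$, so that $k_{l/2}=k_{l/2+1}=l-1$ and all other exponents are distinct. Under the adjoint action of $\mathfrak s_0$, $\mathfrak g$ is a direct sum of irreducible modules $V_1,\dots,V_l$ of dimensions $2k_i+1$. The $V_i$ with $i\ne l/2,l/2+1$ and $W=V_{l/2}\oplus V_{l/2+1}$ are uniquely determined, while $V_{l/2},V_{l/2+1}$ individually are not. Principal basis of $\mathfrak h$: a basis $\{h_1,\dots,h_l\}$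 of $\mathfrak h$ with $\langle h_i\rangle_{\mathbf C}=V_i\cap\mathfrak h$ for $i\ne l/2,l/2+1$ and $\langle h_{l/2},h_{l/2+1}\rangle_{\mathbf C}=W\cap\mathfrak h$; so it is determined (up to constants) modulo a choice of two linearly independent vectors in $W\cap\mathfrak h$. *)

(* Defs.v *)
From HB Require Import structures.
From mathcomp Require Import all_boot all_order all_fingroup all_algebra.
From mathcomp Require Import complex reals.

Set Implicit Arguments.
Unset Strict Implicit.
Unset Printing Implicit Defensive.

Import Order.TTheory GRing.Theory Num.Theory.
Local Open Scope ring_scope.

(* so(n, F) as the Lie algebra of skew-symmetric matrices. *)

Definition add_trmx (F : fieldType) (n : nat) (A : 'M[F]_n) : 'M[F]_n :=
  A + A^T.

Lemma add_trmx_linear (F : fieldType) (n : nat) : linear (@add_trmx F n).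
Proof. by move=> a A B; rewrite /add_trmx !linearP /= scalerDr addrACA. Qed.

HB.instance Definition _ (F : fieldType) (n : nat) :=
  GRing.isLinear.Build F 'M[F]_n 'M[F]_n _ (@add_trmx F n)
    (@add_trmx_linear F n).

Definition so_mx (F : fieldType) (n : nat) : {vspace 'M[F]_n} :=
  lker (linfun (@add_trmx F n)).

Lemma mem_so_mx (F : fieldType) (n : nat) (A : 'M[F]_n) :
  (A \in so_mx F n) = (A^T == - A).
Proof. by rewrite memv_ker lfunE /= /add_trmx addrC addr_eq0. Qed.

Notation so F n := (subvs_of (so_mx F n)).

Definition bracket (F : fieldType) (n : nat) (x y : so F n) : so F n :=
  vsproj (so_mx F n) (vsval x *m vsval y - vsval y *m vsval x).

Lemma bracketE (F : fieldType) (n : nat) (x y : so F n) :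
  vsval (bracket x y) = vsval x *m vsval y - vsval y *m vsval x.
Proof.
rewrite vsprojK //.
have := subvsP x; have := subvsP y.
rewrite !mem_so_mx => /eqP Hy /eqP Hx.
by rewrite linearB /= !trmx_mul Hx Hy !mulNmx !mulmxN !opprK opprB.
Qed.

Definition abelian_subalg (F : fieldType) (n : nat) (h : {vspace so F n}) :=
  {in h &, forall x y, bracket x y = 0}.

Definition ad_semisimple (F : fieldType) (n : nat) (x : so F n) :=
  exists2 b : seq (so F n), basis_of fullv b
    & {in b, forall y, exists a : F, bracket x y = a *: y}.

(* For a semisimple Lie algebra over an algebraically closed field of
   characteristic 0, a Cartan subalgebra is a maximal abelian subalgebra all of
   whose elements are ad-semisimple. *)
Definition cartan_subalg (F : fieldType) (n : nat) (h : {vspace so F n}) :=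
  [/\ abelian_subalg h,
      {in h, forall x, ad_semisimple x}
    & forall h' : {vspace so F n},
        abelian_subalg h' -> (h <= h')%VS -> h' = h].

Definition invariant_form (F : fieldType) (n : nat) (B : {biscalar so F n}) :=
  [/\ forall x y, B x y = B y x,
      forall x y z, B (bracket x y) z = B x (bracket y z)
    & forall x, (forall y, B x y = 0) -> x = 0].

Notation hdual F h := ('Hom(subvs_of h, F^o)).


Definition root_vector (F : fieldType) (n : nat) (h : {vspace so F n})
    (a : hdual F h) (x : so F n) :=
  forall H : subvs_of h, bracket (vsval H) x = (a H : F) *: x.

Definition is_root (F : fieldType) (n : nat) (h : {vspace so F n})
    (a : hdual F h) :=
  a != 0 /\ exists2 x, x != 0 & root_vector a x.

(* sharp is the inverse of flat when B is nondegenerate on h, as it is for an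
   invariant form and a Cartan subalgebra h. *)
Definition flat (F : fieldType) (n : nat) (B : {biscalar so F n})
    (h : {vspace so F n}) : 'Hom(subvs_of h, hdual F h) :=
  linfun (fun H : subvs_of h =>
    linfun (fun H' : subvs_of h => B (vsval H) (vsval H') : F^o)).

Lemma flatE (F : fieldType) (n : nat) (B : {biscalar so F n})
    (h : {vspace so F n}) (H H' : subvs_of h) :
  flat B h H H' = B (vsval H) (vsval H').
Proof.
pose phi (K K' : subvs_of h) : F^o := B (vsval K) (vsval K').
have lin1 K : linear (phi K) by move=> a x y; rewrite /phi !linearP.
pose f1 K : {linear subvs_of h -> F^o} :=
  HB.pack (phi K) (GRing.isLinear.Build _ _ _ _ _ (lin1 K)).
have f1E K K' : linfun (phi K) K' = phi K K' by exact: (lfunE (f1 K)).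
have lin2 : linear (fun K => linfun (phi K)).
  move=> a x y; apply/lfunP => K'; rewrite add_lfunE scale_lfunE !f1E.
  by rewrite /phi linearP linearPl.
pose f2 : {linear subvs_of h -> hdual F h} :=
  HB.pack (fun K => linfun (phi K)) (GRing.isLinear.Build _ _ _ _ _ lin2).
by rewrite -[RHS]/(phi H H') -f1E; congr (fun_of_lfun _ _); exact: (lfunE f2).
Qed.

Definition sharp (F : fieldType) (n : nat) (B : {biscalar so F n})
    (h : {vspace so F n}) (a : hdual F h) : subvs_of h :=
  (flat B h)^-1%VF a.

Definition dual_form (F : fieldType) (n : nat) (B : {biscalar so F n})
    (h : {vspace so F n}) (a b : hdual F h) : F :=
  B (vsval (sharp B a)) (vsval (sharp B b)).

Definition coroot (F : fieldType) (n : nat) (B : {biscalar so F n})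
    (h : {vspace so F n}) (a : hdual F h) : so F n :=
  vsval ((2 / dual_form B a a) *: sharp B a).

Definition nat_comb (F : fieldType) (n l : nat) (h : {vspace so F n})
    (alpha : 'I_l -> hdual F h) (b : hdual F h) :=
  exists m : 'I_l -> nat, b = \sum_i alpha i *+ m i.

Definition simple_roots (F : fieldType) (n l : nat) (h : {vspace so F n})
    (alpha : 'I_l -> hdual F h) :=
  [/\ forall i, is_root (alpha i),
      basis_of fullv [seq alpha i | i <- enum 'I_l]
    & forall b, is_root b -> nat_comb alpha b \/ nat_comb alpha (- b)].

Definition positive_root (F : fieldType) (n l : nat) (h : {vspace so F n})
    (alpha : 'I_l -> hdual F h) (b : hdual F h) :=
  is_root b /\ nat_comb alpha b.

(* Type D_l. Indices are shifted by one: i : 'I_l stands for alpha_(i+1), so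
   the branch node is l - 3 and the two exchanged end nodes are l - 2 and
   l - 1. *)

Definition edgeD (l i j : nat) : bool :=
  ((j == i.+1) && (j < l.-1)%N) || ((i.+3 == l) && (j.+1 == l)).

Definition cartanD (l : nat) (i j : 'I_l) : int :=
  if i == j then 2 else if edgeD l i j || edgeD l j i then -1 else 0.

Definition diagram_swap (l : nat) (i : 'I_l) : 'I_l :=
  insubd i (if i == l.-1 :> nat then l.-2
            else if i == l.-2 :> nat then l.-1 else i).

Definition simple_roots_D (F : fieldType) (n l : nat) (B : {biscalar so F n})
    (h : {vspace so F n}) (alpha : 'I_l -> hdual F h) :=
  simple_roots alpha /\
  forall i j, 2 * dual_form B (alpha i) (alpha j)
                / dual_form B (alpha i) (alpha i) = (cartanD i j)%:~R.

Definition lie_automorphism (F : fieldType) (n : nat) (s : 'End(so F n)) :=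
  bijective s /\ forall x y, s (bracket x y) = bracket (s x) (s y).

Definition order_two (F : fieldType) (n : nat) (s : 'End(so F n)) :=
  (s \o s)%VF = \1%VF /\ s <> \1%VF.

Definition submodule (F : fieldType) (n : nat) (s U : {vspace so F n}) :=
  forall x u, x \in s -> u \in U -> bracket x u \in U.

Definition irreducible_submodule (F : fieldType) (n : nat)
    (s U : {vspace so F n}) :=
  [/\ U <> 0%VS, submodule s U
    & forall U' : {vspace so F n},
        submodule s U' -> (U' <= U)%VS -> U' = 0%VS \/ U' = U].

(* The exponents of D_l, l even, in increasing order:
   1, 3, ..., l - 1, l - 1, ..., 2 l - 5, 2 l - 3. *)
Definition exponentD (l i : nat) : nat :=
  if (i < l./2)%N then i.*2.+1 else i.*2.-1.

(* The two indices with exponent l - 1. *)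
Definition middle (l i : nat) : bool := (i == l./2.-1) || (i == l./2).

Definition isotypic_W (F : fieldType) (n l : nat)
    (V : 'I_l -> {vspace so F n}) : {vspace so F n} :=
  (\sum_(i < l | middle l i) V i)%VS.

Definition principal_decomposition (F : fieldType) (n l : nat)
    (s0 : {vspace so F n}) (V : 'I_l -> {vspace so F n}) :=
  [/\ forall i, irreducible_submodule s0 (V i),
      forall i, \dim (V i) = (2 * exponentD l i + 1)%N,
      directv (\sum_(i < l) V i)
    & (\sum_(i < l) V i)%VS = fullv].

Definition principal_basis (F : fieldType) (n l : nat)
    (V : 'I_l -> {vspace so F n}) (h : {vspace so F n})
    (b : 'I_l -> so F n) :=
  [/\ basis_of h [seq b i | i <- enum 'I_l],
      forall i : 'I_l, ~~ middle l i -> <[b i]>%VS = (V i :&: h)%VS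
    & (\sum_(i < l | middle l i) <[b i]>)%VS = (isotypic_W V :&: h)%VS].

Definition eigenvectors (F : fieldType) (n l : nat) (s : 'End(so F n))
    (b : 'I_l -> so F n) :=
  forall i, exists a : F, b i \in passmx.leigenspace s a.

(* Main.v *)
Require Import Defs.
From HB Require Import structures.
From mathcomp Require Import all_boot all_order all_fingroup all_algebra.
From mathcomp Require Import complex reals.
From mathcomp Require Import ring zify.

Set Implicit Arguments.
Unset Strict Implicit.
Unset Printing Implicit Defensive.

Import Order.TTheory GRing.Theory Num.Theory.
Local Open Scope ring_scope.

(** The principal triple [s0] is fixed by [sigma], because [h0] is the only element
    of the Cartan subalgebra [h] on which every simple root takes the value 2. (It
    takes that value since the reflection in a simple root permutes the other
    positive roots and negates the contributions of their coroots, [sum_pairing].)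
    So [sigma] permutes the irreducible [s0]-submodules. By Schur's lemma
    ([irreducible_sub_isotypic]) it preserves every [V i] whose dimension is not
    repeated, where it acts by a sign, and it preserves [W].

    The sign is found inside [h]. The centralizer of [h0] is [h]
    ([sum_coroots_centralizer]), so every irreducible submodule of dimension
    [2 k + 1] meets [h] in a line, and a generator [z] of this line satisfies
    [ad e0 ^ k z != 0 = ad e0 ^ (k + 1) z] ([irreducible_zero_weight]). On the other
    hand [sigma] permutes the simple coroots, so its [-1]-eigenspace in [h] is the
    line of [u], the difference of the coroots of the two exchanged end nodes. The
    orbit of [u] under [ad e0] can be computed from the Serre relations: it runs from
    the fork down the tail of the Dynkin diagram, one node at a time, and it dies
    after exactly [l] steps ([fork_depth]). An irreducible submodule on which [sigma]
    is [-1] therefore has exponent [l - 1] ([irreducible_g1_dim]), which proves (a).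

    The vector [u] lies in [W], because [sigma] fixes the other summands; so the
    [-1]-part [W1] of [W] is not zero. Neither is the [+1]-part [W0], because
    [W :&: h] is a plane while the [-1]-eigenspace in [h] is a line. A submodule of a
    sum of two irreducible modules of dimension [d] has dimension [0], [d] or [2 d]
    ([dim_submodule_sum2]), so [W0] and [W1] are both irreducible. They are
    orthogonal because their zero weight vectors are, the form on [h] being invariant
    under [sigma]. The statement on principal bases follows, because each [V i] of
    unrepeated dimension, as well as [W0] and [W1], meets [h] in one line.

    The root space decomposition and the Serre relations are derived from the
    axioms of a Cartan subalgebra and of an invariant form; no matrix model of the
    root system is used. *)

(** * The Lie bracket *)

Lemma bracket_linear (F : fieldType) (n : nat) (x : so F n) : linear (bracket x).
Proof.
move=> a y z; apply: val_inj; rewrite [RHS]linearP /= !bracketE linearP /=.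
rewrite mulmxDl -scalemxAl scalerBr opprD addrACA.
by [].
Qed.

HB.instance Definition _ (F : fieldType) (n : nat) (x : so F n) :=
  GRing.isLinear.Build F (so F n) (so F n) _ (bracket x) (bracket_linear x).

Lemma bracketC (F : fieldType) (n : nat) (x y : so F n) :
  bracket x y = - bracket y x.
Proof. by apply: val_inj; rewrite linearN /= !bracketE opprB. Qed.

Lemma bracketDr (F : fieldType) (n : nat) (x y z : so F n) :
  bracket x (y + z) = bracket x y + bracket x z.
Proof. exact: linearD. Qed.

Lemma bracketZr (F : fieldType) (n : nat) (a : F) (x y : so F n) :
  bracket x (a *: y) = a *: bracket x y.
Proof. exact: linearZ. Qed.

Lemma bracketBr (F : fieldType) (n : nat) (x y z : so F n) :
  bracket x (y - z) = bracket x y - bracket x z.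
Proof. exact: linearB. Qed.

Lemma bracket0r (F : fieldType) (n : nat) (x : so F n) : bracket x 0 = 0.
Proof. exact: linear0. Qed.

Lemma bracketPl (F : fieldType) (n : nat) (a : F) (x y z : so F n) :
  bracket (a *: x + y) z = a *: bracket x z + bracket y z.
Proof.
by rewrite bracketC linearP opprD (bracketC x z) (bracketC y z) scalerN.
Qed.

Lemma bracketDl (F : fieldType) (n : nat) (x y z : so F n) :
  bracket (x + y) z = bracket x z + bracket y z.
Proof. by rewrite -[x]scale1r bracketPl !scale1r. Qed.

Lemma bracket0l (F : fieldType) (n : nat) (x : so F n) : bracket 0 x = 0.
Proof. by rewrite bracketC linear0 oppr0. Qed.

Lemma bracketZl (F : fieldType) (n : nat) (a : F) (x y : so F n) :
  bracket (a *: x) y = a *: bracket x y.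
Proof. by rewrite -[a *: x]addr0 bracketPl bracket0l addr0. Qed.

Lemma bracketNl (F : fieldType) (n : nat) (x y : so F n) :
  bracket (- x) y = - bracket x y.
Proof. by rewrite -scaleN1r bracketZl scaleN1r. Qed.

Lemma bracket_suml (F : fieldType) (n : nat) (I : Type) (r : seq I)
    (P : pred I) (x : I -> so F n) (y : so F n) :
  bracket (\sum_(i <- r | P i) x i) y = \sum_(i <- r | P i) bracket (x i) y.
Proof.
apply: (big_morph (fun z => bracket z y)) => [z t|]; first exact: bracketDl.
exact: bracket0l.
Qed.

Lemma jacobi (F : fieldType) (n : nat) (x y z : so F n) :
  bracket x (bracket y z) = bracket (bracket x y) z + bracket y (bracket x z).
Proof.
apply: val_inj; rewrite linearD /= !bracketE.
rewrite !mulmxBl !mulmxBr !mulmxA.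
do ![move: (_ *m _ *m _) => ?].
by apply/matrixP => i j; rewrite !mxE; ring.
Qed.

(** * Eigenvectors and sl2-triples *)

(** Applying [T - a m] kills the last term of a vanishing sum and rescales the
    others by nonzero factors. *)
Lemma eigen_sum0 (F : fieldType) (V : lmodType F) (T : {linear V -> V})
    (m : nat) (a : nat -> F) (v : nat -> V) :
  (forall i, (i < m)%N -> T (v i) = a i *: v i) ->
  (forall i j, (i < m)%N -> (j < m)%N -> a i = a j -> i = j) ->
  \sum_(i < m) v i = 0 -> forall i, (i < m)%N -> v i = 0.
Proof.
elim: m v => [//|m IHm] v Tv a_inj; rewrite big_ord_recr /= => sum0.
pose w i := (a i - a m) *: v i.
have w0 i : (i < m)%N -> w i = 0.
  apply: IHm => [j lt_jm|j k lt_j lt_k|].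
  - by rewrite /w linearZ /= Tv 1?ltnW // !scalerA mulrC.
  - by apply: a_inj; rewrite ltnW.
  have := congr1 (fun x => T x - a m *: x) sum0.
  rewrite linearD linear_sum linear0 scaler0 subr0 Tv // scalerDr opprD addrACA.
  rewrite subrr addr0 scaler_sumr -sumrB => {2}<-.
  by apply: eq_bigr => j _; rewrite /w scalerBl Tv // ltnS ltnW.
have v0 i : (i < m)%N -> v i = 0.
  move=> lt_im; have /eqP := w0 i lt_im; rewrite scaler_eq0 subr_eq0.
  case/orP => /eqP // ai; have e : i = m by apply: a_inj ai => //; apply: ltnW.
  by move: lt_im; rewrite e ltnn.
move: sum0; rewrite big1 ?add0r; last by move=> i _; apply: v0.
by move=> vm0 i; rewrite ltnS leq_eqVlt => /predU1P[->|/v0].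
Qed.

Lemma eigen_free (F : fieldType) (V : vectType F) (T : {linear V -> V})
    (m : nat) (a : nat -> F) (v : nat -> V) :
  (forall i, (i < m)%N -> T (v i) = a i *: v i) ->
  (forall i j, (i < m)%N -> (j < m)%N -> a i = a j -> i = j) ->
  (forall i, (i < m)%N -> v i != 0) -> free [seq v i | i <- iota 0 m].
Proof.
move=> Tv a_inj nz; rewrite (_ : map _ _ = [tuple v i | i < m]); last first.
  by rewrite /= -val_enum_ord -map_comp.
apply/freeP => k; under eq_bigr => i _ do
  rewrite (nth_map i) ?size_enum_ord // nth_ord_enum.
move=> sum0 i; pose k' (j : nat) := if insub j is Some u then k u else 0.
have := @eigen_sum0 _ _ T m a (fun j => k' j *: v j) _ a_inj _ _ (ltn_ord i).
rewrite /k' valK => /(_ _ _)/eqP; rewrite scaler_eq0 (negPf (nz _ _)) // orbF.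
move=> H; apply/eqP; apply: H.
  by move=> j lt_jm; rewrite linearZ /= Tv // !scalerA mulrC.
by rewrite -[RHS]sum0; apply: eq_bigr => j _; rewrite valK.
Qed.

Lemma eigen_seq_vanishes (F : fieldType) (V : vectType F) (T : {linear V -> V})
    (a : nat -> F) (v : nat -> V) :
  (forall i, T (v i) = a i *: v i) -> injective a -> exists k, v k = 0.
Proof.
move=> Tv a_inj; pose m := (dim V).+1.
case: (boolP [exists k : 'I_m, v k == 0]) => [/existsP[k /eqP]|nz].
  by exists k.
have : free [seq v i | i <- iota 0 m].
  apply: (@eigen_free _ _ T _ a) => // [i j _ _|i lt_i]; first exact: a_inj.
  by move: nz; rewrite negb_exists => /forallP/(_ (Ordinal lt_i)).
move/eqP; rewrite size_map size_iota => dimE.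
by have := dimvS (subvf <<[seq v i | i <- iota 0 m]>>); rewrite dimE dimvf ltnn.
Qed.

Lemma bracket_eigen (F : fieldType) (n : nat) (x y v : so F n) (a b : F) :
  bracket x y = a *: y -> bracket x v = b *: v ->
  bracket x (bracket y v) = (b + a) *: bracket y v.
Proof.
by move=> xy xv; rewrite jacobi xy xv bracketZl linearZ /= addrC scalerDl.
Qed.

Lemma bracket_iter_eigen (F : fieldType) (n : nat) (x y v : so F n) (a b : F) k :
  bracket x y = a *: y -> bracket x v = b *: v ->
  bracket x (iter k (bracket y) v) = (b + a *+ k) *: iter k (bracket y) v.
Proof.
move=> xy xv; elim: k => [|k IHk] /=; first by rewrite mulr0n addr0.
by rewrite (bracket_eigen xy IHk) mulrSr addrA.
Qed.

(** The iterates are eigenvectors of [bracket x] for distinct eigenvalues, so in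
    finite dimension they cannot all be nonzero. *)
Lemma bracket_string_end (F : numFieldType) (n : nat) (x y v : so F n)
    (a b : F) :
  a != 0 -> bracket x y = a *: y -> bracket x v = b *: v -> v != 0 ->
  exists p, iter p (bracket y) v != 0 /\ iter p.+1 (bracket y) v = 0.
Proof.
move=> a0 xy xv v0.
have ex : exists k, iter k (bracket y) v == 0.
  have [||k /eqP] := @eigen_seq_vanishes _ _ (bracket x)
    (fun k => b + a *+ k) (fun k => iter k (bracket y) v); last by exists k.
    by move=> k; apply: bracket_iter_eigen.
  by move=> i j /addrI/eqP; rewrite -!(mulr_natr a) (inj_eq (mulfI a0)) eqr_nat => /eqP.
case: (ex_minnP ex) => -[|p] /= /eqP pv min_p; first by rewrite pv eqxx in v0.
exists p; split=> //; apply/negP => /min_p; by rewrite ltnn.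
Qed.

Definition sl2_triple (F : fieldType) (n : nat) (e f h : so F n) :=
  [/\ bracket h e = 2 *: e, bracket h f = - 2 *: f & bracket e f = h].

Lemma sl2_triple_opp (F : fieldType) (n : nat) (e f h : so F n) :
  sl2_triple e f h -> sl2_triple f e (- h).
Proof.
case=> he hf ef; split.
- by rewrite bracketNl hf scaleNr opprK.
- by rewrite bracketNl he scaleNr.
by rewrite bracketC ef.
Qed.

Lemma sl2_raise_lower (F : fieldType) (n : nat) (e f h v : so F n) (mu : F) k :
  sl2_triple e f h -> bracket h v = mu *: v -> bracket e v = 0 ->
  bracket e (iter k.+1 (bracket f) v)
    = (k.+1%:R * (mu - k%:R)) *: iter k (bracket f) v.
Proof.
case=> he hf ef hv ev; elim: k => [|k IHk] /=.
  by rewrite jacobi ef hv ev linear0 addr0 mul1r subr0.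
rewrite jacobi ef [bracket e _]IHk linearZ /=.
rewrite -[bracket f (iter k _ _)]/(iter k.+1 (bracket f) v).
rewrite (bracket_iter_eigen _ hf hv) -scalerDl; congr (_ *: _).
by rewrite -mulr_natr -!natr1; ring.
Qed.

(** Raising the last nonzero vector of the string gives back the previous one
    times a factor that has to vanish, which determines the weight. *)
Lemma sl2_highest_weight (F : numFieldType) (n : nat) (e f h v : so F n)
    (mu : F) :
  sl2_triple e f h -> v != 0 -> bracket h v = mu *: v -> bracket e v = 0 ->
  exists m : nat, [/\ mu = m%:R, iter m (bracket f) v != 0
                    & iter m.+1 (bracket f) v = 0].
Proof.
move=> tr v0 hv ev; have [he hf ef] := tr.
have [|m [fm0 fm1]] := bracket_string_end _ hf hv v0.
  by rewrite oppr_eq0 pnatr_eq0.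
exists m; split=> //; have := sl2_raise_lower m tr hv ev.
rewrite fm1 linear0 => /esym/eqP; rewrite scaler_eq0 (negPf fm0) orbF.
by rewrite mulf_eq0 pnatr_eq0 /= subr_eq0 => /eqP.
Qed.

Lemma sl2_lowest_weight (F : numFieldType) (n : nat) (e f h v : so F n)
    (mu : F) :
  sl2_triple e f h -> v != 0 -> bracket h v = mu *: v -> bracket f v = 0 ->
  exists m : nat, [/\ mu = - m%:R, iter m (bracket e) v != 0
                    & iter m.+1 (bracket e) v = 0].
Proof.
move=> /sl2_triple_opp tr v0 hv fv.
have [|m [mE ? ?]] := sl2_highest_weight (mu := - mu) tr v0 _ fv.
  by rewrite bracketNl hv scaleNr.
by exists m; split=> //; rewrite -mE opprK.
Qed.

(** The top of the string through [v] has weight [m + 2 p], and lowering a highest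
    weight vector gives nonzero vectors down to the opposite weight; stopping after
    [m + p] steps reaches weight [- m]. *)
Lemma sl2_string (F : numFieldType) (n : nat) (e f h v : so F n) (m : nat) :
  sl2_triple e f h -> v != 0 -> bracket h v = m%:R *: v ->
  exists p, iter (m + p) (bracket f) (iter p (bracket e) v) != 0.
Proof.
move=> tr v0 hv; have [he hf ef] := tr.
have [|p [ep0 ep1]] := bracket_string_end _ he hv v0.
  by rewrite pnatr_eq0.
exists p; have hep := bracket_iter_eigen p he hv.
have [N [/eqP NE fN _]] := sl2_highest_weight tr ep0 hep ep1.
have {}NE : N = (m + p + p)%N.
  apply/eqP; rewrite -(eqr_nat F) -(eqP NE) !natrD -mulr_natr; apply/eqP; ring.
by move: fN; rewrite NE addnC iterD; apply: contraNneq => ->; rewrite iter_fix ?linear0.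
Qed.

(** * The root space decomposition *)

Lemma semisimple_basis (F : fieldType) (n : nat) (x : so F n) :
  ad_semisimple x ->
  exists m (b : m.-tuple (so F n)) (a : 'I_m -> F),
    basis_of fullv b /\ forall i : 'I_m, bracket x b`_i = a i *: b`_i.
Proof.
case=> b bB ev; exists (size b), (in_tuple b).
have /fin_all_exists[a aE] : forall i : 'I_(size b), exists c : F,
    bracket x b`_i = c *: b`_i by move=> i; apply/ev/mem_nth.
by exists a.
Qed.

Lemma semisimple_ker (F : fieldType) (n : nat) (x y : so F n) :
  ad_semisimple x -> bracket x (bracket x y) = 0 -> bracket x y = 0.
Proof.
case/semisimple_basis=> m [b [a [bB ev]]].
have {1 2}-> := coord_basis bB (memvf y).
rewrite !linear_sum /=; under eq_bigr do rewrite linearZ /= ev linearZ /= linearZ /= ev.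
move=> sum0; rewrite big1 // => i _; rewrite linearZ /= ev.
have /freeP/(_ (fun i => coord b i y * a i * a i)) := basis_free bB.
move=> /(_ _ i) ca0; apply/eqP; rewrite scalerA scaler_eq0 mulf_eq0.
have /eqP : coord b i y * a i * a i = 0.
  by apply: ca0; rewrite -[RHS]sum0; apply: eq_bigr => j _; rewrite !scalerA.
by rewrite !mulf_eq0; case: (a i == 0); rewrite ?orbT ?orbF // => ->.
Qed.

Section SemisimpleStable.
Variables (F : fieldType) (n : nat) (x : so F n).
Hypothesis x_ss : ad_semisimple x.
Variable U : so F n -> Prop.
Hypothesis U_lin : forall a y z, U y -> U z -> U (a *: y + z).
Hypothesis U_stable : forall y, U y -> U (bracket x y).

Let shift (y : so F n) (a : F) : so F n := bracket x y - a *: y.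

Let U_sum (I : eqType) (r : seq I) (G : I -> so F n) y :
  U y -> {in r, forall i, U (G i)} -> U (\sum_(i <- r) G i + y).
Proof.
move=> Uy; elim: r => [|i r IHr] UG; first by rewrite big_nil add0r.
rewrite big_cons -addrA -[G i]scale1r; apply: U_lin; first exact/UG/mem_head.
by apply: IHr => j jr; apply: UG; rewrite inE jr orbT.
Qed.

Let shift_decomposition s : uniq s -> forall y, U y -> foldl shift y s = 0 ->
  exists2 zs : seq (F * so F n), y = \sum_(z <- zs) z.2 &
    {in zs, forall z, [/\ z.1 \in s, U z.2 & bracket x z.2 = z.1 *: z.2]}.
Proof.
elim: s => [|a s IHs] /=; first by move=> _ y _ ->; exists [::]; rewrite ?big_nil.
case/andP=> a_s uniq_s y Uy killed.
have Ushift : U (shift y a).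
  by rewrite /shift addrC -scaleNr; apply: U_lin => //; apply: U_stable.
have [zs defzs zsP] := IHs uniq_s _ Ushift killed.
pose w (z : F * so F n) := (z.1 - a)^-1 *: z.2.
have Uw z : z \in zs -> U (w z).
  move=> /zsP[_ Uz _]; have := U_lin ((z.1 - a)^-1 - 1) Uz Uz.
  by rewrite scalerBl scale1r subrK.
have nz z : z \in zs -> z.1 - a != 0.
  by case/zsP=> zs1 _ _; rewrite subr_eq0; apply: contraNneq a_s => <-.
pose y' := y - \sum_(z <- zs) w z.
exists ((a, y') :: [seq (z.1, w z) | z <- zs]).
  by rewrite big_cons big_map /= subrK.
move=> z; rewrite inE => /predU1P[->|/mapP[t tzs ->]] /=; last first.
  have [t1 Ut tx] := zsP t tzs; rewrite inE t1 orbT; split=> //.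
    exact: Uw.
  by rewrite linearZ /= tx /w !scalerA mulrC.
rewrite mem_head; split=> //.
  rewrite /y' addrC -sumrN; apply: U_sum => // t /Uw Ut.
  have := U_lin (- 1 - 1) Ut Ut; by rewrite scalerBl scaleN1r scale1r subrK.
have shift_w t : t \in zs -> bracket x (w t) - a *: w t = t.2.
  move=> tzs; have [_ _ tx] := zsP t tzs.
  by rewrite linearZ /= tx !scalerA -scalerBl [a * _]mulrC -mulrBr mulVf ?scale1r ?nz.
apply/eqP; rewrite -subr_eq0 /y' linearB scalerBr opprB [_ - a *: y]addrC addrACA.
rewrite [- _ + a *: _]addrC -[a *: _ - _]opprB -/(shift y a) defzs subr_eq0; apply/eqP.
rewrite linear_sum scaler_sumr -sumrB /=; apply: eq_big_seq => t tzs.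
by rewrite shift_w.
Qed.

Let shift_eigen s y c : bracket x y = c *: y ->
  foldl shift y s = (\prod_(a <- s) (c - a)) *: y.
Proof.
elim: s y => [|a s IHs] y xy /=; first by rewrite big_nil scale1r.
have sy : shift y a = (c - a) *: y by rewrite /shift xy scalerBl.
have xsy : bracket x (shift y a) = c *: shift y a.
  by rewrite sy linearZ /= xy !scalerA mulrC.
by rewrite (IHs _ xsy) sy big_cons scalerA mulrC.
Qed.

Let shift_linear s : linear (fun y => foldl shift y s).
Proof.
elim: s => [|a s IHs] k y z //=; rewrite -IHs; congr (foldl _ _ _).
rewrite /shift linearP /= scalerDr opprD addrACA scalerBr !scalerA.
by rewrite mulrC.
Qed.

(** A product of shifts by the distinct eigenvalues of [ad x] kills the whole
    algebra; peeling off one factor at a time writes an element of [U] as a sum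
    of eigenvectors that never leave [U], where expanding it in an arbitrary
    eigenbasis of [ad x] would leave [U]. *)
Lemma semisimple_stable_ind (P : so F n -> Prop) :
  P 0 -> (forall y z, P y -> P z -> P (y + z)) ->
  (forall y a, U y -> bracket x y = a *: y -> P y) -> forall y, U y -> P y.
Proof.
move=> P0 PD Peig y Uy.
have [m [b [a [bB ev]]]] := semisimple_basis x_ss.
pose s := undup (codom a).
have killed z : foldl shift z s = 0.
  pose L : {linear so F n -> so F n} :=
    HB.pack (fun y => foldl shift y s)
      (GRing.isLinear.Build _ _ _ _ _ (shift_linear s)).
  rewrite -[LHS]/(L z) [z](coord_basis bB (memvf z)) linear_sum big1 // => i _.
  rewrite linearZ /= (shift_eigen _ (ev i)) (big_rem (a i)) /=.
    by rewrite subrr mul0r scale0r scaler0.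
  by rewrite mem_undup codom_f.
have [zs -> zsP] := shift_decomposition (undup_uniq _) Uy (killed y).
rewrite big_seq; apply: big_ind => // z /zsP[_ Uz xz]; exact: Peig xz.
Qed.

End SemisimpleStable.

Lemma stable_eigenvector (F : fieldType) (n : nat) (x : so F n)
    (U : {vspace so F n}) :
  ad_semisimple x -> U <> 0%VS -> {in U, forall y, bracket x y \in U} ->
  exists a v, [/\ v \in U, v != 0 & bracket x v = a *: v].
Proof.
move=> x_ss /eqP U0 Ust.
have pickU : vpick U != 0 by rewrite vpick0.
move: pickU; pose P (y : so F n) := y != 0 ->
  exists a v, [/\ v \in U, v != 0 & bracket x v = a *: v].
rewrite -/(P _).
apply: (@semisimple_stable_ind _ _ x x_ss (fun y => y \in U) _ Ust P).
- by move=> a y z yU zU; rewrite memvD ?memvZ.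
- by rewrite /P eqxx.
- move=> y z Py Pz; have [->|y0 _] := eqVneq y 0; last exact: Py.
  by rewrite add0r.
- by move=> y a yU xy y0; exists a, y.
exact: memv_pick.
Qed.

(** Commuting semisimple elements have a common eigenbasis; it is stated as an
    induction principle because it serves only to extend additive properties from
    eigenvectors to all elements. *)
Lemma common_eigen_ind (F : fieldType) (n : nat) (L : seq (so F n))
    (P : so F n -> Prop) :
  {in L, forall x, ad_semisimple x} ->
  {in L &, forall x y, bracket x y = 0} ->
  P 0 -> (forall y z, P y -> P z -> P (y + z)) ->
  (forall y, {in L, forall x, exists a, bracket x y = a *: y} -> P y) ->
  forall y, P y.
Proof.
move=> L_ss L_com P0 PD; elim: L L_ss L_com => [_ _ Pw y|x L IHL L_ss L_com Pw].
  exact: Pw.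
apply: IHL => [y yL|y z yL zL|z zw].
- by apply: L_ss; rewrite inE yL orbT.
- by apply: L_com; rewrite inE ?yL ?zL orbT.
have x_ss : ad_semisimple x by apply: L_ss; rewrite mem_head.
pose U y := {in L, forall t, forall a, bracket t z = a *: z -> bracket t y = a *: y}.
apply: (semisimple_stable_ind x_ss (U := U)) => //.
- move=> a y t Uy Ut s sL c sz.
  by rewrite linearP /= (Uy s sL c sz) (Ut s sL c sz) scalerDr !scalerA mulrC.
- move=> y Uy t tL a tz.
  have tx : bracket t x = 0 by apply: L_com; rewrite inE ?tL ?orbT ?eqxx.
  by rewrite jacobi (Uy t tL a tz) linearZ /= tx bracket0l add0r.
move=> y a Uy xy; apply: Pw => t; rewrite inE => /predU1P[->|tL].
  by exists a.
by have [c tz] := zw t tL; exists c; apply: Uy.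
Qed.

Section CartanSubalgebra.
Variables (F : fieldType) (n : nat) (h : {vspace so F n}).
Hypothesis h_cartan : cartan_subalg h.

Lemma cartan_bracket x y : x \in h -> y \in h -> bracket x y = 0.
Proof. by case: h_cartan => ab _ _; apply: ab. Qed.

Lemma cartan_semisimple x : x \in h -> ad_semisimple x.
Proof. by case: h_cartan => _ ss _; apply: ss. Qed.

(** Adjoining to a Cartan subalgebra an element that commutes with it gives a
    larger abelian subalgebra, against maximality. *)
Lemma cartan_centralizer x : {in h, forall H, bracket H x = 0} -> x \in h.
Proof.
move=> hx; case: h_cartan => h_ab _ h_max.
rewrite -[h](h_max (h + <[x]>)%VS).
- by rewrite memvE addvSr.
- move=> y z /memv_addP[H Hh [_ /vlineP[a ->] ->]].
  move=> /memv_addP[H' Hh' [_ /vlineP[b ->] ->]].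
  have xx : bracket x x = 0 by apply: val_inj; rewrite /= bracketE subrr.
  rewrite bracketDl !bracketDr !bracketZl !bracketZr h_ab // hx // xx.
  by rewrite [bracket x H']bracketC hx // !(scaler0, oppr0, addr0).
exact: addvSl.
Qed.

Lemma root_vector0 (x : so F n) : root_vector (0 : hdual F h) x <-> x \in h.
Proof.
split=> [x0|xh H]; last by rewrite zero_lfunE scale0r cartan_bracket ?subvsP.
apply: cartan_centralizer => H Hh; have := x0 (vsproj h H).
by rewrite vsprojK // zero_lfunE scale0r.
Qed.

Lemma root_vectorP (x : so F n) :
  {in h, forall H, exists a, bracket H x = a *: x} ->
  exists a : hdual F h, root_vector a x.
Proof.
move=> xw; have [->|x0] := eqVneq x 0.
  by exists 0 => H; rewrite linear0 scaler0.
pose phi (H : subvs_of h) : F^o := coord [tuple x] ord0 (bracket (vsval H) x).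
have phi_lin : linear phi.
  by move=> a y z; rewrite /phi !linearP /= bracketPl linearP.
pose f : {linear subvs_of h -> F^o} :=
  HB.pack phi (GRing.isLinear.Build _ _ _ _ _ phi_lin).
exists (linfun f) => H; rewrite lfunE /= /phi.
have [a ->] := xw _ (subvsP H).
by rewrite linearZ /= (coord_free ord0 ord0) ?seq1_free // eqxx mulr1.
Qed.

(** The root space decomposition, as an induction principle; the zero weight space
    is [h] itself because a Cartan subalgebra is its own centralizer. *)
Lemma root_ind (P : so F n -> Prop) :
  (forall y z, P y -> P z -> P (y + z)) -> {in h, forall y, P y} ->
  (forall (a : hdual F h) y, a != 0 -> root_vector a y -> P y) ->
  forall y, P y.
Proof.
move=> PD Ph Proot; have hb := vbasis_mem.
apply: (@common_eigen_ind _ _ (vbasis h)) => //.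
- by move=> x /hb/cartan_semisimple.
- by move=> x y /hb xh /hb yh; apply: cartan_bracket.
- exact/Ph/mem0v.
move=> y yw; have [a ya] : exists a : hdual F h, root_vector a y.
  apply: root_vectorP => H Hh.
  have /fin_all_exists[c cE] : forall i : 'I_(\dim h),
      exists a, bracket (vbasis h)`_i y = a *: y.
    by move=> i; apply: yw; apply: mem_nth; rewrite size_tuple.
  exists (\sum_i coord (vbasis h) i H * c i); rewrite {1}(coord_vbasis Hh).
  rewrite bracket_suml scaler_suml; apply: eq_bigr => i _.
  by rewrite bracketZl cE scalerA.
have [a0|a0] := eqVneq a 0; last exact: Proot ya.
by apply: Ph; apply/root_vector0; rewrite -a0.
Qed.

Lemma root_vectorZ (a : hdual F h) x c :
  root_vector a x -> root_vector a (c *: x).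
Proof. by move=> ax H; rewrite linearZ /= ax !scalerA mulrC. Qed.

Lemma root_vectorD (a : hdual F h) x y :
  root_vector a x -> root_vector a y -> root_vector a (x + y).
Proof. by move=> ax ay H; rewrite linearD /= ax ay scalerDr. Qed.

Lemma root_vector_bracket (a b : hdual F h) x y :
  root_vector a x -> root_vector b y -> root_vector (a + b) (bracket x y).
Proof.
move=> ax ay H; rewrite (bracket_eigen (ax H) (ay H)) add_lfunE.
by rewrite addrC.
Qed.

Lemma root_vector_iter (a b : hdual F h) x y k :
  root_vector a x -> root_vector b y ->
  root_vector (b + a *+ k) (iter k (bracket x) y).
Proof.
move=> ax ay; elim: k => [|k IHk] /=; first by rewrite addr0.
by rewrite mulrS addrCA; apply: root_vector_bracket.
Qed.

Lemma not_root_vector (a : hdual F h) x :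
  a != 0 -> ~ is_root a -> root_vector a x -> x = 0.
Proof.
move=> a0 nr ax; have [//|x0] := eqVneq x 0; case: nr; split=> //; by exists x.
Qed.

(** * The invariant form on the Cartan subalgebra *)

Variable B : {biscalar so F n}.
Hypothesis B_inv : invariant_form B.

Lemma invariant_formC x y : B x y = B y x. Proof. by case: B_inv. Qed.

Lemma form_bracket x y z : B (bracket x y) z = B x (bracket y z).
Proof. by case: B_inv. Qed.

Lemma cartan_root_orthogonal (a : hdual F h) H x :
  a != 0 -> root_vector a x -> H \in h -> B H x = 0.
Proof.
move=> /lfunPn[K]; rewrite zero_lfunE => aK ax Hh.
have : a K * B H x = 0.
  by rewrite -linearZ /= -ax -form_bracket cartan_bracket ?subvsP ?linear0l.
by move/eqP; rewrite mulf_eq0 (negPf aK) => /eqP.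
Qed.

(** The root spaces are orthogonal to [h], so an element of [h] orthogonal to [h] is
    orthogonal to everything. *)
Lemma form_nondegenerate_cartan H :
  H \in h -> {in h, forall K, B H K = 0} -> H = 0.
Proof.
move=> Hh HK; case: B_inv => _ _; apply.
apply: root_ind => [y z Hy Hz|//|a y a0 ay].
  by rewrite linearD /= Hy Hz addr0.
exact: cartan_root_orthogonal ay Hh.
Qed.

(** Nondegeneracy on [h] makes [flat] injective, hence surjective by dimension, so
    [sharp] is a genuine inverse. *)
Lemma form_sharp (a : hdual F h) (H : subvs_of h) :
  B (vsval (sharp B a)) (vsval H) = a H.
Proof.
have inj : lker (flat B h) == 0%VS.
  apply/lker0P => x y /lfunP xy; apply/val_inj/eqP; rewrite -subr_eq0 /=.
  apply/eqP/form_nondegenerate_cartan => [|K Kh].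
    by rewrite memvB ?subvsP.
  have := xy (vsproj h K); rewrite !flatE vsprojK // => e.
  by rewrite linearBl /= e subrr.
have full : limg (flat B h) = fullv.
  apply/eqP; rewrite eqEdim subvf limg_dim_eq ?(eqP inj) ?capv0 //.
  by rewrite !dimvf /dim /= muln1.
by rewrite -flatE /sharp limg_lfunVK // full memvf.
Qed.

Lemma sharp_unique (a : hdual F h) (H : subvs_of h) :
  (forall K : subvs_of h, B (vsval H) (vsval K) = a K) -> H = sharp B a.
Proof.
move=> HK; apply/val_inj/eqP; rewrite -subr_eq0 /=.
apply/eqP/form_nondegenerate_cartan => [|K Kh].
  by rewrite memvB ?subvsP.
have := HK (vsproj h K); have := form_sharp a (vsproj h K).
by rewrite vsprojK // linearBl /= => -> ->; rewrite subrr.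
Qed.

Lemma dual_formE (a b : hdual F h) : dual_form B a b = a (sharp B b).
Proof. exact: form_sharp. Qed.

Lemma dual_formC (a b : hdual F h) : dual_form B a b = dual_form B b a.
Proof. exact: invariant_formC. Qed.

(** Both sides lie in the Cartan subalgebra and pair alike with it. *)
Lemma bracket_opposite_roots (a : hdual F h) x y :
  root_vector a x -> root_vector (- a) y ->
  bracket x y = B x y *: vsval (sharp B a).
Proof.
move=> ax ay; have xyh : bracket x y \in h.
  by apply/root_vector0; rewrite -(subrr a); apply: root_vector_bracket.
apply/eqP; rewrite -subr_eq0; apply/eqP/form_nondegenerate_cartan => [|K Kh].
  by rewrite memvB ?memvZ ?subvsP.
have := ay (vsproj h K); have := form_sharp a (vsproj h K).
rewrite opp_lfunE vsprojK // => aK yK.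
rewrite linearBl linearZl_LR /= aK form_bracket bracketC yK.
by rewrite scaleNr opprK linearZ /= mulrC subrr.
Qed.

End CartanSubalgebra.

(** * Simple roots and the sum of the positive coroots *)

Section SimplyLaced.
Variables (F : numFieldType) (n l : nat) (h : {vspace so F n}).
Hypothesis h_cartan : cartan_subalg h.
Variable B : {biscalar so F n}.
Hypothesis B_inv : invariant_form B.
Variable alpha : 'I_l -> hdual F h.
Hypothesis alpha_simple : simple_roots alpha.
Variable A : 'I_l -> 'I_l -> int.
Hypothesis A_diag : forall i, A i i = 2.
Hypothesis form_simple : forall i j,
  dual_form B (alpha i) (alpha j) = (A i j)%:~R.
Variables e f : 'I_l -> so F n.
Hypothesis e_root : forall i, root_vector (alpha i) (e i).
Hypothesis f_root : forall i, root_vector (- alpha i) (f i).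
Hypothesis ef1 : forall i, B (e i) (f i) = 1.

Let dual_formP c (a b d : hdual F h) :
  dual_form B (c *: a + b) d = c * dual_form B a d + dual_form B b d.
Proof.
by rewrite !(dual_formE h_cartan B_inv) add_lfunE scale_lfunE.
Qed.

Let dual_formPr c (a b d : hdual F h) :
  dual_form B d (c *: a + b) = c * dual_form B d a + dual_form B d b.
Proof. by rewrite !(dual_formC B_inv d) dual_formP. Qed.

Let dual_form_suml (I : Type) (r : seq I) (P : pred I) (a : I -> hdual F h) d :
  dual_form B (\sum_(i <- r | P i) a i) d
    = \sum_(i <- r | P i) dual_form B (a i) d.
Proof.
rewrite (dual_formE h_cartan B_inv) sum_lfunE.
by apply: eq_bigr => i _; rewrite (dual_formE h_cartan B_inv).
Qed.

Definition simple_coef i (b : hdual F h) : F :=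
  coord [tuple alpha j | j < l] i b.

Let alpha_basis : basis_of fullv [tuple alpha j | j < l].
Proof. by case: alpha_simple. Qed.

Lemma simple_coef_alpha i j : simple_coef i (alpha j) = (i == j)%:R.
Proof.
rewrite /simple_coef; have <- : [tuple alpha j | j < l]`_j = alpha j.
  by rewrite (nth_map j) ?size_enum_ord // nth_ord_enum.
by rewrite coord_free ?(basis_free alpha_basis) // eq_sym.
Qed.

Lemma simple_coefK b : b = \sum_i simple_coef i b *: alpha i.
Proof.
rewrite {1}(coord_basis alpha_basis (memvf b)); apply: eq_bigr => i _.
by congr (_ *: _); rewrite (nth_map i) ?size_enum_ord // nth_ord_enum.
Qed.

Lemma simple_coefP i c a b :
  simple_coef i (c *: a + b) = c * simple_coef i a + simple_coef i b.
Proof. exact: linearP. Qed.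

Lemma simple_coefN i b : simple_coef i (- b) = - simple_coef i b.
Proof. exact: linearN. Qed.

Lemma nat_comb_coef b :
  nat_comb alpha b <-> exists m : 'I_l -> nat, forall i, simple_coef i b = (m i)%:R.
Proof.
split=> [[m ->]|[m mE]]; exists m.
  move=> i; rewrite /simple_coef linear_sum (bigD1 i) //=.
  rewrite -scaler_nat linearZ /= -/(simple_coef _ _) simple_coef_alpha eqxx mulr1.
  rewrite big1 ?addr0 // => j ji.
  rewrite -scaler_nat linearZ /= -/(simple_coef _ _) simple_coef_alpha eq_sym.
  by rewrite (negPf ji) mulr0.
rewrite {1}[b]simple_coefK; apply: eq_bigr => i _; by rewrite mE scaler_nat.
Qed.

Lemma root_coef_int b : is_root b -> exists m : 'I_l -> int, forall i,
  simple_coef i b = (m i)%:~R.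
Proof.
case: alpha_simple => _ _ /[apply].
case=> /nat_comb_coef[m mE]; first by exists (fun i => (m i)%:Z).
exists (fun i => - (m i)%:Z) => i; rewrite mulrNz; apply/esym/eqP.
by rewrite eqr_oppLR -simple_coefN mE.
Qed.

(** The coefficients of a root all have one sign, so a single positive one decides. *)
Lemma positive_rootP b :
  positive_root alpha b <-> is_root b /\ exists i, 0 < simple_coef i b.
Proof.
split=> [[br bn]|[br [i bi]]]; split=> //.
  move/nat_comb_coef: bn => [m mE].
  case: (boolP [exists i, m i != 0%N]) => [/existsP[i mi]|].
    by exists i; rewrite mE ltr0n lt0n.
  rewrite negb_exists => /forallP m0; case: br => /eqP[].
  rewrite [b]simple_coefK big1 // => i _.
  by move/negbNE/eqP: (m0 i) (mE i) => -> ->; rewrite scale0r.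
case: alpha_simple => _ _ /(_ b br)[] // /nat_comb_coef[m mE].
by move: bi; rewrite -oppr_lt0 -simple_coefN mE ltrn0.
Qed.

Lemma positive_coef_ge0 b i : positive_root alpha b -> 0 <= simple_coef i b.
Proof. by case=> _ /nat_comb_coef[m ->]. Qed.

Lemma corootE i : coroot B (alpha i) = vsval (sharp B (alpha i)).
Proof. by rewrite /coroot form_simple A_diag divff ?pnatr_eq0 // scale1r. Qed.

Lemma coroot_cartan (b : hdual F h) : coroot B b \in h.
Proof. exact: subvsP. Qed.

Lemma coroot_root_vector i (b : hdual F h) x : root_vector b x ->
  bracket (coroot B (alpha i)) x = dual_form B b (alpha i) *: x.
Proof. by move=> bx; rewrite corootE bx (dual_formE h_cartan B_inv). Qed.

Lemma simple_e_neq0 i : e i != 0.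
Proof. by apply/eqP => e0; have /eqP := ef1 i; rewrite e0 linear0l eq_sym oner_eq0. Qed.

Lemma simple_sl2 i : sl2_triple (e i) (f i) (coroot B (alpha i)).
Proof.
split.
- by rewrite (coroot_root_vector i (e_root i)) form_simple A_diag.
- rewrite (coroot_root_vector i (f_root i)) -scaleN1r -[- 1 *: _]addr0.
  rewrite dual_formP form_simple A_diag mulN1r (dual_formE h_cartan B_inv).
  by rewrite zero_lfunE addr0.
rewrite (bracket_opposite_roots h_cartan B_inv (e_root i) (f_root i)).
by rewrite ef1 scale1r corootE.
Qed.

(** A difference of two simple roots has coefficients of both signs, so it is not a
    root. *)
Lemma simple_ef0 i j : i != j -> bracket (e i) (f j) = 0.
Proof.
move=> ij; apply: (@not_root_vector _ _ _ (alpha i - alpha j)).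
- apply: contraNneq ij => /(congr1 (simple_coef i)) /eqP.
  rewrite addrC -scaleN1r simple_coefP !simple_coef_alpha eqxx /simple_coef.
  by rewrite linear0; case: (i =P j); rewrite // mulr0 add0r oner_eq0.
- case: alpha_simple => _ _ H /H[] /nat_comb_coef[m mE].
      have := mE j; rewrite addrC -scaleN1r simple_coefP !simple_coef_alpha.
    rewrite eqxx eq_sym (negPf ij) addr0 mulr1 => /eqP.
    by rewrite eqr_oppLR -addr_eq0 -(natrD _ 1) pnatr_eq0.
  have := mE i; rewrite opprB addrC -scaleN1r simple_coefP !simple_coef_alpha.
  rewrite eqxx (negPf ij) addr0 mulr1 => /eqP.
  by rewrite eqr_oppLR -addr_eq0 -(natrD _ 1) pnatr_eq0.
exact: root_vector_bracket.
Qed.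

(** [e j] is a lowest weight vector for the triple of [alpha i], of weight [A j i]. *)
Lemma serre_relation i j (m : nat) :
  i != j -> A j i = - m%:Z -> iter m.+1 (bracket (e i)) (e j) = 0.
Proof.
move=> ij Aji; have fe : bracket (f i) (e j) = 0.
  by rewrite bracketC simple_ef0 ?oppr0 // eq_sym.
have := coroot_root_vector i (e_root j); rewrite form_simple Aji => he.
have [k [mk _]] := sl2_lowest_weight (simple_sl2 i) (simple_e_neq0 j) he fe.
have -> // : k = m.
by move/eqP: mk; rewrite mulrNz eqr_opp pmulrn eqr_nat => /eqP.
Qed.

Lemma root_form_int b i : is_root b ->
  exists z : int, dual_form B b (alpha i) = z%:~R.
Proof.
move=> /root_coef_int[m mE]; exists (\sum_j m j * A j i).
rewrite {1}[b]simple_coefK dual_form_suml rmorph_sum; apply: eq_bigr => j _.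
rewrite -[_ *: _]addr0 dual_formP (dual_formE h_cartan B_inv 0) zero_lfunE addr0.
by rewrite mE form_simple rmorphM.
Qed.

Definition reflection i (b : hdual F h) : hdual F h :=
  - dual_form B b (alpha i) *: alpha i + b.

Lemma form_reflection_alpha i b :
  dual_form B (reflection i b) (alpha i) = - dual_form B b (alpha i).
Proof. by rewrite dual_formP form_simple A_diag; ring. Qed.

Lemma reflectionK i : involutive (reflection i).
Proof.
move=> b; rewrite {1}/reflection form_reflection_alpha /reflection addrA.
by rewrite -scalerDl addNr scale0r add0r.
Qed.

Lemma form_reflection i b :
  dual_form B (reflection i b) (reflection i b) = dual_form B b b.
Proof.
rewrite {2}/reflection dual_formPr form_reflection_alpha {1}/reflection dual_formP.
by rewrite (dual_formC B_inv (alpha i)); ring.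
Qed.

(** The extreme vectors of the string of [b] in the direction of [alpha i] exist
    because the ladder operators act nilpotently; walking down from the top one
    passes through the reflected weight. *)
Lemma root_reflection i b : is_root b -> is_root (reflection i b).
Proof.
move=> br; have [b0 [x x0 bx]] := br; split.
  apply: contraNneq b0 => r0; rewrite -(reflectionK i b) r0 /reflection addr0.
  by rewrite (dual_formE h_cartan B_inv) zero_lfunE oppr0 scale0r.
have [z zE] := root_form_int i br; rewrite /reflection zE.
have hx : bracket (coroot B (alpha i)) x = z%:~R *: x.
  by rewrite (coroot_root_vector i bx) zE.
have [z0|z0] := leP 0 z.
  have [m zm] : exists m : nat, z = m by exists `|z|%N; rewrite gez0_abs.
  rewrite zm in hx *.
  have [p nz] := sl2_string (simple_sl2 i) x0 hx; eexists; first exact: nz.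
  have := root_vector_iter (m + p) (f_root i) (root_vector_iter p (e_root i) bx).
  congr (root_vector _ _); rewrite mulNrn mulrnDr opprD addrACA subrr addr0.
  by rewrite addrC scaleNr scaler_nat.
have [m zm] : exists m : nat, z = - m%:Z.
  by exists `|z|%N; rewrite ltz0_abs ?opprK.
have hx' : bracket (- coroot B (alpha i)) x = m%:R *: x.
  by rewrite bracketNl hx zm mulrNz scaleNr opprK.
have [p nz] := sl2_string (sl2_triple_opp (simple_sl2 i)) x0 hx'.
eexists; first exact: nz.
have := root_vector_iter (m + p) (e_root i) (root_vector_iter p (f_root i) bx).
congr (root_vector _ _); rewrite mulNrn mulrnDr addrACA [- _ + _]addrC subrr addr0.
by rewrite addrC zm mulrNz opprK scaler_nat.
Qed.

(** The difference of the two sides is killed by [f i] although its weight is 2,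
    while lowest weights are never positive. *)
Lemma simple_root_space i x :
  root_vector (alpha i) x -> x = B x (f i) *: e i.
Proof.
move=> ax; pose y := x - B x (f i) *: e i.
have ay : root_vector (alpha i) y.
  by rewrite /y -scaleNr; apply: root_vectorD => //; apply: root_vectorZ.
apply/eqP; rewrite -subr_eq0 -/y; apply: contraT => y0.
have fy : bracket (f i) y = 0.
  rewrite bracketC (bracket_opposite_roots h_cartan B_inv ay (f_root i)).
  by rewrite /y linearBl linearZl_LR /= ef1 mulr1 subrr scale0r oppr0.
have := coroot_root_vector i ay; rewrite form_simple A_diag => hy.
have [m [/eqP]] := sl2_lowest_weight (simple_sl2 i) y0 hy fy.
by rewrite -addr_eq0 -(natrD _ 2) pnatr_eq0.
Qed.

(** The top vector of the string through a multiple of [alpha i] would generate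
    a module passing through [e i] at a place where raising is not zero. *)
Lemma simple_root_multiple i c :
  0 < c -> is_root (c *: alpha i) -> c = 1.
Proof.
move=> c0 cr; have [m mE] := root_coef_int cr.
have cm : c = (m i)%:~R.
  rewrite -mE -[c *: _]addr0 simple_coefP simple_coef_alpha eqxx.
  by rewrite /simple_coef linear0 addr0 mulr1.
have [k ck] : exists k : nat, c = k.+1%:R.
  move: c0; rewrite cm ltr0z => m0; exists `|m i|.-1%N.
  rewrite prednK ?absz_gt0 ?gt_eqF //.
  by rewrite -[in LHS](gtz0_abs m0).
move: cr; rewrite ck => -[_ [x x0 bx]] {c c0 m mE cm ck}.
case: k => [//|k] in bx *; have [he hf ef] := simple_sl2 i.
have hx := coroot_root_vector i bx.
have [|p [xp0 xp1]] := bracket_string_end _ he hx x0; first by rewrite pnatr_eq0.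
set x' := iter p _ x in xp0 xp1.
have bx' : root_vector (alpha i *+ (k + p).+2) x'.
  have := root_vector_iter p (e_root i) bx; congr (root_vector _ _).
  by rewrite scaler_nat -mulrnDr.
have hx' : bracket (coroot B (alpha i)) x' = (2 * (k + p).+2%:R) *: x'.
  rewrite (coroot_root_vector i bx').
  have -> : alpha i *+ (k + p).+2 = (k + p).+2%:R *: alpha i + 0.
    by rewrite scaler_nat addr0.
  rewrite dual_formP.
  rewrite form_simple A_diag (dual_formE h_cartan B_inv 0) zero_lfunE addr0.
  by rewrite mulrC.
have [N [/eqP NE fN _]] := sl2_highest_weight (simple_sl2 i) xp0 hx' xp1.
move: NE; rewrite -natrM eqr_nat => /eqP NE.
have low j : (j <= N)%N -> iter j (bracket (f i)) x' != 0.
  move=> jN; move: fN; rewrite -(subnK jN) iterD; apply: contraNneq => ->.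
  by elim: (_ - _)%N => //= q /eqP ->; rewrite linear0.
have ey := sl2_raise_lower (k + p) (simple_sl2 i) hx' xp1.
have ay : root_vector (alpha i) (iter (k + p).+1 (bracket (f i)) x').
  have := root_vector_iter (k + p).+1 (f_root i) bx'; congr (root_vector _ _).
  by rewrite mulNrn -mulrnBr // subSnn.
move: ey; rewrite {1}(simple_root_space ay) bracketZr.
have -> : bracket (e i) (e i) = 0 by apply: val_inj; rewrite /= bracketE subrr.
rewrite scaler0 => /esym/eqP; rewrite scaler_eq0 (negPf (low _ _)) ?orbF; last by lia.
rewrite mulf_eq0 pnatr_eq0 /= -natrM -natrB ?pnatr_eq0; lia.
Qed.

Lemma reflection_positive i b :
  positive_root alpha b -> b != alpha i -> positive_root alpha (reflection i b).
Proof.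
move=> bp bi; have [br _] := bp; apply/positive_rootP; split.
  exact: root_reflection.
case: (boolP [exists j, (j != i) && (simple_coef j b != 0)]) => [|none].
  case/existsP=> j /andP[ji bj]; exists j.
  rewrite /reflection simple_coefP simple_coef_alpha (negPf ji) mulr0 add0r.
  by rewrite lt0r bj positive_coef_ge0.
case/eqP: bi; have bE : b = simple_coef i b *: alpha i.
  rewrite {1}[b]simple_coefK (bigD1 i) //= big1 ?addr0 // => j ji.
  move: none; rewrite negb_exists => /forallP/(_ j); rewrite ji negbK => /eqP ->.
  by rewrite scale0r.
have c0 : 0 < simple_coef i b.
  rewrite lt0r positive_coef_ge0 // andbT; apply/eqP => c0.
  by case: br => /eqP[]; rewrite bE c0 scale0r.
have c1 : simple_coef i b = 1 by apply: (simple_root_multiple (i := i)); rewrite -?bE.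
by rewrite bE c1 scale1r.
Qed.

Variable pos : seq (hdual F h).
Hypothesis pos_uniq : uniq pos.
Hypothesis posP : forall b, b \in pos <-> positive_root alpha b.

Variable h0 : so F n.
Hypothesis h0E : h0 = \sum_(b <- pos) coroot B b.

Let pairing i b := 2 / dual_form B b b * dual_form B b (alpha i).

Let simple_positive i : alpha i \in pos.
Proof.
apply/posP/positive_rootP; split; first by case: alpha_simple.
by exists i; rewrite simple_coef_alpha eqxx ltr01.
Qed.

(** The reflection in [alpha i] permutes the positive roots other than [alpha i]
    and negates their coroots' values at [alpha i]; only the coroot of [alpha i]
    itself contributes. *)
Lemma sum_pairing i : \sum_(b <- pos) pairing i b = 2.
Proof.
rewrite (big_rem (alpha i)) ?simple_positive //=.
have -> : pairing i (alpha i) = 2.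
  by rewrite /pairing form_simple A_diag divfK ?pnatr_eq0.
pose r := rem (alpha i) pos; set S := \sum_(_ <- _) _.
have r_uniq : uniq r by apply: rem_uniq.
have memr b : (b \in r) = (b != alpha i) && (b \in pos) by rewrite mem_rem_uniq.
have refl_r b : b \in r -> reflection i b \in r.
  rewrite !memr => /andP[bi /posP bp]; apply/andP; split; last first.
    by apply/posP/reflection_positive.
  apply/eqP=> rb; have bE := reflectionK i b; rewrite rb in bE.
  have := positive_coef_ge0 i bp; rewrite -bE /reflection simple_coefP.
  rewrite simple_coef_alpha eqxx form_simple A_diag mulr1 -{1}[2]/(1 + 1).
  by rewrite opprD subrK oppr_ge0 ler10.
have r_perm : perm_eq [seq reflection i b | b <- r] r.
  apply: uniq_perm => //.
    by rewrite map_inj_uniq //; apply: inv_inj (reflectionK i).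
  move=> b; apply/mapP/idP => [[d dr ->]|br]; first exact: refl_r.
  by exists (reflection i b); rewrite ?reflectionK ?refl_r.
have S_opp : S = - S.
  rewrite {1}/S -/r -(perm_big _ r_perm) /= big_map -sumrN; apply: eq_bigr => b _.
  by rewrite /pairing form_reflection form_reflection_alpha mulrN.
suff -> : S = 0 by rewrite addr0.
by apply/eqP; move/eqP: S_opp; rewrite -addr_eq0 -mulr2n mulrn_eq0.
Qed.

Lemma sum_coroots_cartan : h0 \in h.
Proof. by rewrite h0E; apply: rpred_sum => b _; apply: coroot_cartan. Qed.

Lemma simple_sum_coroots i : alpha i (vsproj h h0) = 2.
Proof.
have -> : vsproj h h0 = \sum_(b <- pos) (2 / dual_form B b b) *: sharp B b.
  by rewrite h0E linear_sum; apply: eq_bigr => b _ /=; rewrite vsvalK.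
rewrite linear_sum -[RHS](sum_pairing i) /=; apply: eq_bigr => b _.
rewrite linearZ /pairing (dual_formC B_inv b (alpha i)).
by rewrite (dual_formE h_cartan B_inv (alpha i)).
Qed.

Lemma root_sum_coroots_neq0 b : is_root b -> b (vsproj h h0) != 0.
Proof.
move=> br; have [b0 _] := br.
have comb0 d : nat_comb alpha d -> d (vsproj h h0) = 0 -> d = 0.
  case=> m dE; rewrite {1}dE sum_lfunE.
  have val i : (alpha i *+ m i) (vsproj h h0) = (2 * m i)%:R.
    by rewrite -scaler_nat scale_lfunE simple_sum_coroots natrM mulrC.
  under eq_bigr do rewrite val.
  rewrite -natr_sum => /eqP; rewrite pnatr_eq0 sum_nat_eq0 => /forallP m0.
  rewrite dE big1 // => i _; have := m0 i; rewrite /= muln_eq0 /= => /eqP ->.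
  by rewrite mulr0n.
apply: contraNneq b0 => bh0.
case: alpha_simple => _ _ /(_ b br)[] /comb0; first by move->.
by rewrite opp_lfunE bh0 oppr0 => /(_ erefl)/eqP; rewrite oppr_eq0.
Qed.

(** [ad h0] is semisimple, so its image meets its kernel trivially, and every
    root vector lies in its image. *)
Lemma sum_coroots_centralizer x : bracket h0 x = 0 -> x \in h.
Proof.
move=> h0x; have [H [y [Hh xE]]] : exists H y, H \in h /\ x = H + bracket h0 y.
  move: x {h0x}; apply: (root_ind h_cartan) => [x y|H Hh|b y b0 by_].
  - move=> [H [z [Hh ->]]] [K [t [Kh ->]]]; exists (H + K), (z + t).
    by rewrite memvD // bracketDr addrACA.
  - by exists H, 0; rewrite bracket0r addr0.
  exists 0; have [->|y0] := eqVneq y 0.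
    by exists 0; rewrite bracket0r addr0 mem0v.
  have br : is_root b by split=> //; exists y.
  exists ((b (vsproj h h0))^-1 *: y); rewrite mem0v add0r bracketZr.
  have := by_ (vsproj h h0); rewrite vsprojK ?sum_coroots_cartan // => ->.
  by rewrite scalerA mulVf ?scale1r ?root_sum_coroots_neq0.
have h0H := cartan_bracket h_cartan sum_coroots_cartan Hh.
have ss := cartan_semisimple h_cartan sum_coroots_cartan.
move: h0x; rewrite xE bracketDr h0H add0r => /(semisimple_ker ss) ->.
by rewrite addr0.
Qed.

Lemma h0_bracket_e i : bracket h0 (e i) = 2 *: e i.
Proof.
have := e_root i (vsproj h h0).
by rewrite vsprojK ?sum_coroots_cartan // simple_sum_coroots.
Qed.

Lemma h0_bracket_f i : bracket h0 (f i) = - 2 *: f i.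
Proof.
have := f_root i (vsproj h h0).
by rewrite vsprojK ?sum_coroots_cartan // opp_lfunE simple_sum_coroots.
Qed.

Lemma principal_sl2 (c : 'I_l -> F) :
  h0 = \sum_i c i *: coroot B (alpha i) ->
  sl2_triple (\sum_i e i) (\sum_i c i *: f i) h0.
Proof.
move=> h0c; split.
- rewrite linear_sum scaler_sumr /=; apply: eq_bigr => i _.
  exact: h0_bracket_e.
- rewrite linear_sum scaler_sumr /=; apply: eq_bigr => i _.
  by rewrite bracketZr h0_bracket_f !scalerA mulrC.
rewrite bracket_suml h0c; apply: eq_bigr => i _.
rewrite linear_sum (bigD1 i) //= big1 ?addr0 => [|j ji].
  by rewrite bracketZr; have [_ _ ->] := simple_sl2 i.
by rewrite bracketZr simple_ef0 ?scaler0 // eq_sym.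
Qed.

Lemma coroots_basis : basis_of h [seq coroot B (alpha i) | i <- enum 'I_l].
Proof.
have lE : \dim h = l.
  have := size_basis alpha_basis; rewrite dimvf /dim /= muln1.
  exact.
rewrite basisEfree size_map size_enum_ord lE leqnn andbT; apply/andP; split.
  rewrite (_ : map _ _ = [tuple coroot B (alpha i) | i < l]) //.
  apply/freeP => k; under eq_bigr => i _ do
    rewrite (nth_map i) ?size_enum_ord // nth_ord_enum.
  move=> sum0 i; have k0 : \sum_j k j *: alpha j = 0.
    apply/lfunP => H; rewrite zero_lfunE sum_lfunE -[RHS](linear0l B (vsval H)).
    rewrite -sum0 linear_sumlz; apply: eq_bigr => j _.
    by rewrite scale_lfunE linearZl_LR /= corootE form_sharp.
  have := congr1 (simple_coef i) k0; rewrite /simple_coef linear_sum linear0.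
  rewrite (bigD1 i) //= big1 => [|j ji].
    by rewrite addr0 linearZ /= -/(simple_coef _ _) simple_coef_alpha eqxx mulr1.
  by rewrite linearZ /= -/(simple_coef _ _) simple_coef_alpha eq_sym (negPf ji) mulr0.
apply/span_subvP => _ /mapP[i _ ->]; exact: coroot_cartan.
Qed.

End SimplyLaced.

(** * Climbing the forked diagram *)

Section Fork.
Variables (F : numFieldType) (n : nat) (a : nat -> so F n) (p q : so F n).
Hypothesis a_com : forall i j, (i.+1 < j)%N -> bracket (a i) (a j) = 0.
Hypothesis a_serreS : forall i, bracket (a i) (bracket (a i) (a i.+1)) = 0.
Hypothesis a_serreP : forall i, bracket (a i.+1) (bracket (a i.+1) (a i)) = 0.
Hypothesis pq_com : bracket p q = 0.
Hypothesis ap_com : forall i, bracket (a i.+1) p = 0.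
Hypothesis aq_com : forall i, bracket (a i.+1) q = 0.
Hypothesis ap_serre : bracket (a 0) (bracket (a 0) p) = 0.
Hypothesis aq_serre : bracket (a 0) (bracket (a 0) q) = 0.
Hypothesis pa_serre : bracket p (bracket p (a 0)) = 0.
Hypothesis qa_serre : bracket q (bracket q (a 0)) = 0.

(** Here [p] and [q] stand for the root vectors at the two prongs of a fork, [a 0]
    for the one at the branch node, and [a 1], [a 2], ... for those along the tail.
    Modelled on the vector representation of the odd orthogonal algebra, the chain
    starts from the antisymmetric vector [p - q] and climbs down the tail one node
    at a time. Every other node vector annihilates each vector of the chain, so
    climbing is the same as applying the sum of all of them. *)
Fixpoint fork_chain k : so F n :=
  if k is k'.+1 then bracket (a k') (fork_chain k') else p - q.

Let a_com' i j : (i.+1 < j)%N -> bracket (a j) (a i) = 0.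
Proof. by move=> ij; rewrite bracketC a_com ?oppr0. Qed.

Let com_bracket (x y z : so F n) :
  bracket x y = 0 -> bracket x (bracket y z) = bracket y (bracket x z).
Proof. by move=> xy; rewrite jacobi xy bracket0l add0r. Qed.

Let chain_above j k : (k < j)%N -> bracket (a j) (fork_chain k) = 0.
Proof.
elim: k j => [|k IHk] [//|j] kj /=.
  by rewrite bracketBr ap_com aq_com subrr.
by rewrite com_bracket ?a_com' // IHk ?bracket0r // ltnW.
Qed.

Let serre_chain (x y z : so F n) :
  bracket x (bracket x y) = 0 -> bracket x z = 0 ->
  bracket x (bracket x (bracket y z)) = 0.
Proof.
move=> xxy xz; rewrite [bracket x (bracket y z)]jacobi xz bracket0r addr0.
by rewrite jacobi xxy xz bracket0l bracket0r addr0.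
Qed.

(** By the Jacobi identity the left-hand side below is equal both to
    [bracket (bracket x y) (bracket x z)] and to the opposite of it. *)
Let serre_sandwich (x y z : so F n) :
  bracket x (bracket x y) = 0 -> bracket y z = 0 ->
  bracket x (bracket x z) = 0 -> bracket x (bracket y (bracket x z)) = 0.
Proof.
move=> xxy yz xxz; set t := bracket x _.
have tE : t = bracket x (bracket (bracket y x) z).
  by rewrite /t [bracket y (bracket x z)]jacobi yz bracket0r addr0.
suff /eqP : t = - t.
  by rewrite -addr_eq0 -mulr2n -scaler_nat scaler_eq0 pnatr_eq0 => /eqP.
rewrite {1}tE jacobi [bracket x (bracket y x)]jacobi.
have -> : bracket x x = 0 by apply: val_inj; rewrite /= bracketE subrr.
rewrite bracket0r addr0 [bracket (bracket x y) x]bracketC xxy oppr0 bracket0l add0r.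
rewrite [bracket y x]bracketC bracketNl; congr (- _).
by rewrite /t [RHS]jacobi xxz bracket0r addr0.
Qed.

(** Nodes already visited act by zero: the Serre relation takes care of the last
    one, [serre_sandwich] of the one before, and the earlier ones commute with the
    last step. *)
Let chain_below j k : (j < k)%N -> bracket (a j) (fork_chain k) = 0.
Proof.
have diag i : bracket (a i) (fork_chain i.+1) = 0.
  case: i => [|i] /=; first by rewrite !bracketBr ap_serre aq_serre subrr.
  by rewrite serre_chain ?chain_above.
elim: k => [//|k IHk]; rewrite ltnS leq_eqVlt => /predU1P[->|jk]; first exact: diag.
have [kE|jk2] := eqVneq k j.+1.
  rewrite kE /=; apply: serre_sandwich => //; exact: chain_above.
rewrite /= com_bracket ?IHk ?bracket0r // a_com //; lia.
Qed.

Lemma fork_chain_fixed j k : j != k -> bracket (a j) (fork_chain k) = 0.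
Proof. by rewrite neq_ltn => /orP[/chain_below|/chain_above]. Qed.

(** The two end nodes contribute terms that cancel because the chain starts from
    an antisymmetric combination of them. *)
Lemma fork_chain_ends k : bracket (p + q) (fork_chain k) = 0.
Proof.
have qp : bracket q p = 0 by rewrite bracketC pq_com oppr0.
have sq (x : so F n) : bracket x x = 0 by apply: val_inj; rewrite /= bracketE subrr.
case: k => [|k].
  by rewrite /= bracketDl !bracketBr !sq pq_com qp !subr0 addr0.
elim: k => [|k IHk] /=; last first.
  rewrite com_bracket ?IHk ?bracket0r // bracketDl.
  by rewrite [bracket p _]bracketC [bracket q _]bracketC ap_com aq_com oppr0 addr0.
rewrite bracketDl !bracketBr.
have -> : bracket p (bracket (a 0) p) = 0.
  by rewrite [bracket (a 0) p]bracketC linearN /= pa_serre oppr0.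
have -> : bracket q (bracket (a 0) q) = 0.
  by rewrite [bracket (a 0) q]bracketC linearN /= qa_serre oppr0.
have -> : bracket p (bracket (a 0) q) = bracket q (bracket (a 0) p).
  rewrite [LHS]jacobi pq_com bracket0r addr0 bracketC.
  by rewrite [bracket p (a 0)]bracketC linearN /= opprK.
by rewrite sub0r subr0 addNr.
Qed.

Variables (N : nat) (b hh : nat -> so F n).
Hypothesis ba_com : forall i j, (i < N)%N -> i != j -> bracket (b i) (a j) = 0.
Hypothesis bp_com : forall i, (i < N)%N -> bracket (b i) p = 0.
Hypothesis bq_com : forall i, (i < N)%N -> bracket (b i) q = 0.
Hypothesis ab_hh : forall i, (i < N)%N -> bracket (a i) (b i) = hh i.
Hypothesis hh_a : forall i j, (i < N)%N -> (j < i)%N ->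
  bracket (hh i) (a j) = - (i == j.+1)%:R *: a j.
Hypothesis hh_p : forall i, (i < N)%N -> bracket (hh i) p = - (i == 0)%:R *: p.
Hypothesis hh_q : forall i, (i < N)%N -> bracket (hh i) q = - (i == 0)%:R *: q.

Let chain_weight i k : (i < N)%N -> (k <= i)%N ->
  bracket (hh i) (fork_chain k) = - (i == k)%:R *: fork_chain k.
Proof.
move=> iN; elim: k => [_|k IHk ki] /=.
  by rewrite bracketBr hh_p // hh_q // scalerBr.
rewrite (bracket_eigen (hh_a iN ki) (IHk (ltnW ki))).
by rewrite (gtn_eqF ki) oppr0 add0r.
Qed.

Let chain_lower0 i k : (i < N)%N -> (k <= i)%N -> bracket (b i) (fork_chain k) = 0.
Proof.
move=> iN; elim: k => [_|k IHk ki] /=.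
  by rewrite bracketBr bp_com // bq_com // subrr.
by rewrite com_bracket ?IHk ?bracket0r // 1?ltnW // ba_com // gtn_eqF.
Qed.

(** Each step can be undone by the lowering vector of its node, which kills the
    previous vector of the chain, of weight [- 1]. *)
Lemma fork_chain_neq0 k : p != q -> (k <= N)%N -> fork_chain k != 0.
Proof.
move=> pq; elim: k => [_|k IHk kN]; first by rewrite subr_eq0.
have e : bracket (b k) (fork_chain k.+1) = fork_chain k.
  rewrite /= jacobi chain_lower0 // bracket0r addr0 [bracket (b k) _]bracketC.
  by rewrite ab_hh // bracketNl chain_weight // eqxx scaleN1r opprK.
by have := IHk (ltnW kN); rewrite -e; apply: contraNneq => ->; rewrite linear0.
Qed.

Hypothesis a_out : forall i, (N <= i)%N -> a i = 0.

Lemma fork_chain_iter k :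
  iter k (bracket (\sum_(i < N) a i + (p + q))) (p - q) = fork_chain k.
Proof.
elim: k => [//|k IHk]; rewrite iterS IHk bracketDl fork_chain_ends addr0.
rewrite bracket_suml /=; have [kN|Nk] := ltnP k N.
  rewrite (bigD1 (Ordinal kN)) //= big1 ?addr0 // => i ik.
  by rewrite fork_chain_fixed.
rewrite a_out // bracket0l big1 // => i _; rewrite fork_chain_fixed //.
by rewrite ltn_eqF // (leq_trans (ltn_ord i)).
Qed.

Lemma fork_chain_end : fork_chain N.+1 = 0.
Proof. by rewrite /= a_out // bracket0l. Qed.

End Fork.

(** * Type D *)

Section TypeD.
Variables (F : numFieldType) (n l : nat).
Hypothesis l_ge4 : (4 <= l)%N.
Variable h : {vspace so F n}.
Hypothesis h_cartan : cartan_subalg h.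
Variable B : {biscalar so F n}.
Hypothesis B_inv : invariant_form B.
Variable alpha : 'I_l -> hdual F h.
Hypothesis alpha_simple : simple_roots alpha.
Hypothesis form_simple : forall i j,
  dual_form B (alpha i) (alpha j) = (cartanD i j)%:~R.
Variables e f : 'I_l -> so F n.
Hypothesis e_root : forall i, root_vector (alpha i) (e i).
Hypothesis f_root : forall i, root_vector (- alpha i) (f i).
Hypothesis ef1 : forall i, B (e i) (f i) = 1.

Lemma cartanD_diag (i : 'I_l) : cartanD i i = 2.
Proof. by rewrite /cartanD eqxx. Qed.

(** Nodes are addressed by natural numbers, so that arithmetic on positions stays
    outside the ordinal type; for [l <= k] the value is a placeholder. *)
Definition node (k : nat) : 'I_l := insubd (Ordinal l_ge4 : 'I_l) k.

Lemma val_node k : (k < l)%N -> node k = k :> nat.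
Proof. by move=> kl; rewrite val_insubd kl. Qed.

Lemma nodeK (i : 'I_l) : node i = i.
Proof. by apply: ord_inj; rewrite val_node. Qed.

Lemma node_eq i j : (i < l)%N -> (j < l)%N -> (node i == node j) = (i == j).
Proof.
move=> il jl; apply/eqP/eqP => [/(congr1 (@nat_of_ord l))|->//].
by rewrite !val_node.
Qed.

Let E k := e (node k).
Let G k := f (node k).
Let H k := coroot B (alpha (node k)).

Let adj i j := edgeD l i j || edgeD l j i.

Let adjC i j : adj i j = adj j i.
Proof. by rewrite /adj orbC. Qed.

Let cartan_node i j : (i < l)%N -> (j < l)%N ->
  cartanD (node i) (node j) = if i == j then 2 else if adj i j then -1 else 0.
Proof.
by move=> il jl; rewrite /cartanD node_eq // !val_node.
Qed.

Let node_neq i j : (i < l)%N -> (j < l)%N -> i != j -> node i != node j.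
Proof. by move=> il jl; rewrite node_eq. Qed.

Let EE0 i j : (i < l)%N -> (j < l)%N -> i != j -> ~~ adj i j ->
  bracket (E i) (E j) = 0.
Proof.
move=> il jl ij nij.
apply: (serre_relation h_cartan B_inv alpha_simple cartanD_diag form_simple
  e_root f_root ef1 (m := 0)); first exact: node_neq.
by rewrite cartan_node // eq_sym (negPf ij) adjC (negPf nij).
Qed.

Let EEE0 i j : (i < l)%N -> (j < l)%N -> i != j ->
  bracket (E i) (bracket (E i) (E j)) = 0.
Proof.
move=> il jl ij; case: (boolP (adj i j)) => aij; last first.
  by rewrite EE0 // bracket0r.
apply: (serre_relation h_cartan B_inv alpha_simple cartanD_diag form_simple
  e_root f_root ef1 (m := 1)); first exact: node_neq.
by rewrite cartan_node // eq_sym (negPf ij) adjC aij.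
Qed.

Let GE0 i j : (i < l)%N -> (j < l)%N -> i != j -> bracket (G i) (E j) = 0.
Proof.
move=> il jl ij; rewrite bracketC.
by rewrite (simple_ef0 alpha_simple e_root f_root) ?oppr0 // node_neq // eq_sym.
Qed.

Let EG i : bracket (E i) (G i) = H i.
Proof.
by have [] := simple_sl2 h_cartan B_inv cartanD_diag form_simple
  e_root f_root ef1 (node i).
Qed.

Let HE i j : (i < l)%N -> (j < l)%N ->
  bracket (H i) (E j) = (if i == j then 2 else if adj i j then -1 else 0) *: E j.
Proof.
move=> il jl.
rewrite (coroot_root_vector h_cartan B_inv cartanD_diag form_simple
  (node i) (e_root (node j))).
rewrite form_simple cartan_node // eq_sym adjC.
by case: (i == j) => //; case: ifP.
Qed.

Let a k := if (k < l - 2)%N then E (l - 3 - k) else 0.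
Let p := E (l - 2).
Let q := E (l - 1).

Let sum_e : \sum_i e i = \sum_(i < l - 2) a i + (p + q).
Proof.
have -> : \sum_i e i = \sum_(0 <= i < l) E i.
  by rewrite big_mkord; apply: eq_bigr => i _; rewrite /E nodeK.
have split_sum m : \sum_(0 <= i < m.+2) E i
    = \sum_(i < m) E (m - i.+1) + (E m + E m.+1).
  rewrite !big_nat_recr //= -addrA; congr (_ + _).
  by rewrite big_mkord (reindex_inj rev_ord_inj).
have := split_sum (l - 2)%N; rewrite (_ : (l - 2).+2 = l); last by lia.
rewrite (_ : (l - 2).+1 = l - 1)%N; last by lia.
move=> ->; congr (_ + _); apply: eq_bigr => i _.
by rewrite /a ltn_ord; congr E; lia.
Qed.

Let u := H (l - 2) - H (l - 1).

(** The two end nodes see [u] with opposite signs and all other nodes with value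
    zero. *)
Let bracket_u : bracket (\sum_i e i) u = - 2 *: (p - q).
Proof.
rewrite sum_e bracketC !linearD /= linear_sum big1 /=; last first.
  move=> i _; rewrite /a; case: ifP => il; last by rewrite bracket0r.
  rewrite /u bracketDl bracketNl !HE; try lia.
  have -> : adj (l - 2) (l - 3 - i) = adj (l - 1) (l - 3 - i).
    by rewrite /adj /edgeD; lia.
  by rewrite !ifN_eq ?subrr //; lia.
have nadj : adj (l - 2) (l - 1) = false by rewrite /adj /edgeD; lia.
have up : bracket u p = 2 *: p.
  rewrite /u bracketDl bracketNl !HE ?eqxx ?ifN_eq 1?adjC ?nadj ?scale0r ?subr0 //; lia.
have uq : bracket u q = - 2 *: q.
  rewrite /u bracketDl bracketNl !HE ?eqxx ?ifN_eq ?nadj ?scale0r ?sub0r ?scaleNr //; lia.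
by rewrite up uq oppr0 add0r !scaleNr scalerN !opprK.
Qed.

Let a_com i j : (i.+1 < j)%N -> bracket (a i) (a j) = 0.
Proof.
move=> ij; rewrite /a; case: ifP => il; last by rewrite bracket0l.
case: ifP => jl; last by rewrite bracket0r.
by apply: EE0; rewrite /adj /edgeD; lia.
Qed.

Let aa_serre i j : i != j -> bracket (a i) (bracket (a i) (a j)) = 0.
Proof.
move=> ij; rewrite /a; case: ifP => il; last by rewrite bracket0l.
case: ifP => jl; last by rewrite !bracket0r.
by apply: EEE0; lia.
Qed.

Let a_end i k : (l - 2 <= k < l)%N -> bracket (a i.+1) (E k) = 0.
Proof.
move=> kl; rewrite /a; case: ifP => il; last by rewrite bracket0l.
by apply: EE0; rewrite /adj /edgeD; lia.
Qed.

Let a0_end k : (l - 2 <= k < l)%N ->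
  bracket (a 0) (bracket (a 0) (E k)) = 0 /\ bracket (E k) (bracket (E k) (a 0)) = 0.
Proof.
by move=> kl; rewrite /a ifT; last lia; split; apply: EEE0; lia.
Qed.

(** One application of the sum of the [e i] turns [u] into a multiple of the first
    vector of the chain; [l - 2] more steps visit the branch node and the tail, and
    then no node is left. *)
Lemma fork_depth :
  let u := coroot B (alpha (node (l - 2))) - coroot B (alpha (node (l - 1))) in
  [/\ bracket (\sum_i e i) u != 0,
      iter l.-1 (bracket (\sum_i e i)) u != 0
    & iter l (bracket (\sum_i e i)) u = 0].
Proof.
rewrite -/(H _) -/(H _) -/u /=.
have kp : (l - 2 <= l - 2 < l)%N by lia.
have kq : (l - 2 <= l - 1 < l)%N by lia.
have pq_com : bracket p q = 0.
  by apply: EE0; rewrite /adj /edgeD; lia.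
have serreS i : bracket (a i) (bracket (a i) (a i.+1)) = 0.
  by apply: aa_serre; rewrite ltn_eqF.
have serreP i : bracket (a i.+1) (bracket (a i.+1) (a i)) = 0.
  by apply: aa_serre; rewrite gtn_eqF.
have [[ap pa] [aq qa]] := (a0_end kp, a0_end kq).
have a_out i : (l - 2 <= i)%N -> a i = 0 by move=> li; rewrite /a ltnNge li.
have chainE k : iter k (bracket (\sum_i e i)) (p - q) = fork_chain a p q k.
  rewrite sum_e; apply: fork_chain_iter => // i; exact: a_end.
have stepE k : iter k.+1 (bracket (\sum_i e i)) u = - 2 *: fork_chain a p q k.
  rewrite iterSr bracket_u -chainE; elim: k => //= k ->.
  by rewrite bracketZr.
have pq : p != q.
  apply/eqP => pqE; have : bracket (H (l - 2)) p = bracket (H (l - 2)) q by rewrite pqE.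
  rewrite !HE ?eqxx ?ifN_eq; try lia.
  rewrite (_ : adj _ _ = false) ?scale0r; last by rewrite /adj /edgeD; lia.
  by apply/eqP; rewrite scaler_eq0 pnatr_eq0 (simple_e_neq0 ef1).
have nz k : (k <= l - 2)%N -> fork_chain a p q k != 0.
  pose r k := (l - 3 - k)%N.
  apply: (fork_chain_neq0 (b := fun k => G (r k)) (hh := fun k => H (r k))) => //.
  - move=> i j il ij; rewrite /a; case: ifP => jl; last by rewrite bracket0r.
    by apply: GE0; rewrite /r; lia.
  - by move=> i il; apply: GE0; rewrite /r; lia.
  - by move=> i il; apply: GE0; rewrite /r; lia.
  - by move=> i il; rewrite /a il EG.
  - move=> i j il ji; rewrite /a ifT; last by lia.
    rewrite HE ?ifN_eq /r; try lia; congr (_ *: _).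
    have [->|ij] := eqVneq i j.+1.
      by rewrite ifT // /adj /edgeD; lia.
    by rewrite ifF ?oppr0 // /adj /edgeD; lia.
  - move=> i il; rewrite HE ?ifN_eq /r; try lia; congr (_ *: _).
    have [->|i0] := eqVneq i 0.
      by rewrite ifT // /adj /edgeD; lia.
    by rewrite ifF ?oppr0 // /adj /edgeD; lia.
  - move=> i il; rewrite HE ?ifN_eq /r; try lia; congr (_ *: _).
    have [->|i0] := eqVneq i 0.
      by rewrite ifT // /adj /edgeD; lia.
    by rewrite ifF ?oppr0 // /adj /edgeD; lia.
split.
- by rewrite [bracket _ _](stepE 0) scaler_eq0 oppr_eq0 pnatr_eq0 nz.
- rewrite (_ : l.-1 = (l - 2).+1); last by lia.
  by rewrite stepE scaler_eq0 oppr_eq0 pnatr_eq0 nz.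
rewrite [in iter l](_ : l = (l - 2).+2); last by lia.
by rewrite stepE fork_chain_end ?scaler0.
Qed.

End TypeD.

(** * Irreducible submodules *)

Section Submodules.
Variables (F : fieldType) (n : nat) (s0 : {vspace so F n}).

Lemma submodule_cap (U V : {vspace so F n}) :
  submodule s0 U -> submodule s0 V -> submodule s0 (U :&: V)%VS.
Proof.
by move=> Us Vs x u xs; rewrite !memv_cap => /andP[uU uV]; rewrite Us ?Vs.
Qed.

Lemma submodule_add (U V : {vspace so F n}) :
  submodule s0 U -> submodule s0 V -> submodule s0 (U + V)%VS.
Proof.
move=> Us Vs x _ xs /memv_addP[u uU [v vV ->]].
by rewrite bracketDr memv_add ?Us ?Vs.
Qed.

Lemma submodule_img (U : {vspace so F n}) (t : 'End(so F n)) :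
  (forall x u, x \in s0 -> t (bracket x u) = bracket x (t u)) ->
  submodule s0 U -> submodule s0 (t @: U)%VS.
Proof.
move=> tx Us x _ xs /memv_imgP[u uU ->].
by rewrite -tx // memv_img // Us.
Qed.

Lemma submodule_ker (t : 'End(so F n)) :
  (forall x u, x \in s0 -> t (bracket x u) = bracket x (t u)) ->
  submodule s0 (lker t).
Proof.
by move=> tx x u xs; rewrite !memv_ker tx // => /eqP ->; rewrite bracket0r.
Qed.

(** Schur's lemma: the projection to a summand of another dimension vanishes. *)
Lemma irreducible_sub_isotypic l (V : 'I_l -> {vspace so F n})
    (U : {vspace so F n}) :
  (forall i, irreducible_submodule s0 (V i)) -> directv (\sum_(i < l) V i) ->
  (\sum_(i < l) V i)%VS = fullv -> irreducible_submodule s0 U ->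
  (U <= \sum_(i < l | \dim (V i) == \dim U) V i)%VS.
Proof.
move=> V_irr V_dir V_full [U0 U_sub U_irr].
pose t i := sumv_pi_for (esym V_full) i.
have tV i u : t i u \in V i by apply: memv_sum_pi.
have t_sum u : u = \sum_i t i u 
  by rewrite -[LHS](sumv_pi_sum (esym V_full)) ?memvf.
have t_com i x u : x \in s0 -> t i (bracket x u) = bracket x (t i u).
  move=> xs; apply/eqP; rewrite -subr_eq0; apply/eqP.
  have /directv_sum_independent := V_dir.
  move=> /(_ (fun j => t j (bracket x u) - bracket x (t j u))); apply=> [j _||//].
    by have [_ Vs _] := V_irr j; rewrite memvB // Vs.
  by rewrite sumrB -t_sum -linear_sum -t_sum subrr.
apply/subvP => u uU; rewrite {1}(t_sum u) (bigID (fun i => \dim (V i) == \dim U)) /=.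
rewrite [X in _ + X]big1 ?addr0 => [|i dimVi]; first exact: memv_sumr.
have [Vi0 Vi_sub Vi_irr] := V_irr i.
have [||K0|KU] := U_irr (U :&: lker (t i))%VS.
- by apply: submodule_cap => //; apply: submodule_ker => x w; apply: t_com.
- exact: capvSl.
- have := limg_dim_eq K0 => dimI.
  have [||I0|IV] := Vi_irr (t i @: U)%VS.
  + by apply: submodule_img => // x w; apply: t_com.
  + by apply/subvP => _ /memv_imgP[w _ ->].
  + by case: U0; apply/eqP; rewrite -dimv_eq0 -dimI I0 dimv0.
  by rewrite -dimI IV eqxx in dimVi.
by apply/eqP; rewrite -memv_ker; move: uU; rewrite -{1}KU memv_cap => /andP[].
Qed.

(** A submodule [N] is measured against the second summand: both [N :&: V2] and,
    by the modular law, [N + V2] can take only two values. *)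
Lemma dim_submodule_sum2 (V1 V2 N : {vspace so F n}) d :
  irreducible_submodule s0 V1 -> irreducible_submodule s0 V2 ->
  (V1 :&: V2)%VS = 0%VS -> \dim V1 = d -> \dim V2 = d ->
  submodule s0 N -> (N <= V1 + V2)%VS -> \dim N \in [:: 0; d; 2 * d]%N.
Proof.
move=> [_ V1s V1i] [_ V2s V2i] cap0 dim1 dim2 Ns NV.
have dimC : \dim (N :&: V2) \in [:: 0; d]%N.
  have [||->|->] := V2i (N :&: V2)%VS; rewrite ?capvSr ?dimv0 ?dim2 ?inE ?eqxx ?orbT //.
  exact: submodule_cap.
have dimS : \dim (N + V2) \in [:: d; 2 * d]%N.
  have -> : (N + V2 = V2 + (V1 :&: (N + V2)))%VS.
    rewrite vspace_modl ?addvSr // addvC [(V2 + V1)%VS]addvC.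
    by apply/esym/capv_idPr; rewrite subv_add addvSr NV.
  have [||->|->] := V1i (V1 :&: (N + V2))%VS; rewrite ?capvSl //.
  - by apply: submodule_cap => //; apply: submodule_add.
  - by rewrite addv0 dim2 inE eqxx.
  by rewrite addvC dimv_disjoint_sum // dim1 dim2 !inE mul2n addnn eqxx orbT.
have := dimv_sum_cap N V2; rewrite dim2; move: dimC dimS; rewrite !inE; lia.
Qed.

End Submodules.

Section Sl2Module.
Variables (F : numFieldType) (n : nat) (e f h : so F n).
Hypothesis tr : sl2_triple e f h.
Hypothesis h_ss : ad_semisimple h.

Let s0 := <<[:: e; f; h]>>%VS.

Lemma sl2_submodule (U : {vspace so F n}) :
  {in U, forall u, [/\ bracket e u \in U, bracket f u \in U & bracket h u \in U]} ->
  submodule s0 U.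
Proof.
move=> stable x u; rewrite /s0 !span_cons span_nil addv0.
move=> /memv_addP[_ /vlineP[a ->] [y yfh ->]] uU.
move: yfh => /memv_addP[_ /vlineP[b ->] [_ /vlineP[c ->] ->]].
by have [eu fu hu] := stable u uU; rewrite !bracketDl !bracketZl !memvD ?memvZ.
Qed.

Lemma sl2_submodule_stable (U : {vspace so F n}) u :
  submodule s0 U -> u \in U ->
  [/\ bracket e u \in U, bracket f u \in U & bracket h u \in U].
Proof. by move=> Us uU; split; apply: Us => //; rewrite memv_span // !inE eqxx ?orbT. Qed.

(** The lowered images of a highest weight vector have distinct weights and span
    a submodule, hence all of [U]; as there are [2 k + 1] of them, the middle one
    has weight zero and is [k] raising steps away from the top. *)
Lemma irreducible_zero_weight (U : {vspace so F n}) k :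
  irreducible_submodule s0 U -> \dim U = (2 * k + 1)%N ->
  exists z, [/\ z \in U, bracket h z = 0, iter k (bracket e) z != 0,
                iter k.+1 (bracket e) z = 0
              & {in U, forall y, exists c y', y' \in U /\ y = c *: z + bracket h y'}].
Proof.
move=> [U0 Us Ui] dimU; have [he hf ef] := tr.
have [mu [v [vU v0 hv]]] : exists mu v, [/\ v \in U, v != 0 & bracket h v = mu *: v].
  apply: stable_eigenvector => // u uU; by case: (sl2_submodule_stable Us uU).
have [|p [w0 ew]] := bracket_string_end _ he hv v0; first by rewrite pnatr_eq0.
have hw := bracket_iter_eigen p he hv.
have wU : iter p (bracket e) v \in U.
  by elim: (p) => //= q IHq; case: (sl2_submodule_stable Us IHq).
rewrite iterS in ew; move: (mu + _) (iter p _ v) w0 ew hw wU => nu w w0 ew hw wU.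
have [N [nuN fN fN1]] := sl2_highest_weight tr w0 hw ew.
pose b j := iter j (bracket f) w.
have bU j : b j \in U.
  by elim: j => //= j IHj; case: (sl2_submodule_stable Us IHj).
have b0 j : (j <= N)%N -> b j != 0.
  move=> jN; move: fN; rewrite -(subnK jN) iterD; apply: contraNneq => bj.
  by rewrite -/(b j) bj; elim: (_ - _)%N => //= q /eqP ->; rewrite bracket0r.
have hb j : bracket h (b j) = (N%:R - 2 * j%:R) *: b j.
  by rewrite (bracket_iter_eigen j hf hw) nuN mulNrn mulr_natr.
pose S := [seq b j | j <- iota 0 N.+1].
have S_free : free S.
  apply: (eigen_free (T := bracket h) (a := fun j => N%:R - 2 * j%:R)) => [i _||i iN].
  - exact: hb.

  - move=> i j _ _ /addrI/oppr_inj/eqP.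
    by rewrite (inj_eq (mulfI _)) ?pnatr_eq0 // eqr_nat => /eqP.
  - exact: b0.
have bS j : (j <= N)%N -> b j \in <<S>>%VS.
  by move=> jN; apply/memv_span/map_f; rewrite mem_iota.
have S_stable x : (forall j, (j <= N)%N -> bracket x (b j) \in <<S>>%VS) ->
    {in <<S>>%VS, forall u, bracket x u \in <<S>>%VS}.
  move=> xb u uS; rewrite -[bracket x u](lfunE (bracket x)).
  apply: subvP (memv_img _ uS); rewrite limg_span; apply/span_subvP.
  move=> _ /mapP[_ /mapP[j jN ->] ->]; rewrite lfunE /= xb //.
  by move: jN; rewrite mem_iota.
have S_sub : submodule s0 <<S>>%VS.
  apply: sl2_submodule => u uS; split; apply: S_stable uS => j jN.
  - case: j jN => [|j] jN; first by rewrite /b /= ew mem0v.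
    by rewrite (sl2_raise_lower j tr hw ew) memvZ // bS // ltnW.
  - have [->|jN'] := eqVneq j N; first by rewrite -[bracket _ _]/(iter N.+1 _ _) fN1 mem0v.
    by apply: (bS j.+1); rewrite ltn_neqAle jN'.
  - by rewrite hb memvZ // bS.
have SU : <<S>>%VS = U.
  have [||S0|//] := Ui <<S>>%VS => //.
    by apply/span_subvP => _ /mapP[j _ ->].
  by have := bS 0 (leq0n _); rewrite S0 memv0 (negPf (b0 _ _)).
have Nk : N = (2 * k)%N.
  move: S_free; rewrite /free SU dimU size_map size_iota => /eqP; lia.
have eb j : (j <= k)%N -> exists2 c, c != 0 & iter j (bracket e) (b k) = c *: b (k - j)%N.
  elim: j => [_|j IHj jk]; first by exists 1; rewrite ?oner_eq0 // subn0 scale1r.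
  have [c c0 eq_c] := IHj (ltnW jk); rewrite iterS eq_c.
  have -> : (k - j = (k - j.+1).+1)%N by lia.
  rewrite bracketZr /b (sl2_raise_lower _ tr hw ew) scalerA; eexists; last by [].
  rewrite mulf_neq0 // mulf_neq0 ?pnatr_eq0 // nuN -natrB ?pnatr_eq0; lia.
have [c c0 ekb] := eb k (leqnn _); rewrite subnn in ekb.
exists (b k); split=> //.
- by rewrite hb Nk natrM subrr scale0r.
- by rewrite ekb scaler_eq0 negb_or c0 b0.
- by rewrite iterS ekb bracketZr ew scaler0.
rewrite -{1}SU => y; rewrite -[S]in_tupleE => /coord_span ->.
elim/big_ind: _ => [|y1 y2 [c1 [t1 [t1U ->]]] [c2 [t2 [t2U ->]]]|i _].
- by exists 0, 0; rewrite mem0v bracket0r scale0r addr0.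
- exists (c1 + c2), (t1 + t2); rewrite memvD // bracketDr scalerDl addrACA.
  by [].
have iN : (i < N.+1)%N by rewrite -[X in (_ < X)%N](size_iota 0) -(size_map b).
rewrite (nth_map 0%N) ?size_iota // nth_iota // add0n; move: (coord _ _ _) => d.
have [->|ik] := eqVneq (i : nat) k.
  by exists d, 0; rewrite mem0v bracket0r addr0.
exists 0, ((N%:R - 2 * i%:R)^-1 *: (d *: b i)); rewrite !memvZ //; split=> //.
rewrite scale0r add0r !bracketZr hb !scalerA mulrAC mulVf ?mul1r //.
by rewrite Nk -natrM subr_eq0 eqr_nat; lia.
Qed.

End Sl2Module.

(** * The diagram automorphism *)

Definition swap_ends (l a : nat) : nat :=
  if a == l.-1 then l.-2 else if a == l.-2 then l.-1 else a.

Lemma val_diagram_swap l (i : 'I_l) : (2 <= l)%N ->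
  diagram_swap i = swap_ends l i :> nat.
Proof.
move=> l2; rewrite /diagram_swap val_insubd ifT //.
by have := ltn_ord i; case: ifP => _; [|case: ifP => _]; lia.
Qed.

Lemma swap_ends1 l : swap_ends l (l - 1) = (l - 2)%N.
Proof. by rewrite /swap_ends subn1 eqxx subn2. Qed.

Lemma swap_ends2 l : (2 <= l)%N -> swap_ends l (l - 2) = (l - 1)%N.
Proof.
by case: l => [|[|l]] // _; rewrite /swap_ends subn1 subn2 /= eqxx ltn_eqF.
Qed.

Lemma swap_endsK l a : (2 <= l)%N -> swap_ends l (swap_ends l a) = a.
Proof.
case: l => [|[|m]] // _; rewrite /swap_ends /=.
have [->|na] := eqVneq a m.+1; first by rewrite ltn_eqF // eqxx.
have [->|na'] := eqVneq a m; first by rewrite eqxx.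
by rewrite (negPf na) (negPf na').
Qed.

Lemma diagram_swapK l : (2 <= l)%N -> involutive (@diagram_swap l).
Proof. by move=> l2 i; apply: ord_inj; rewrite !val_diagram_swap // swap_endsK. Qed.

Lemma edgeD_swap l a b : (4 <= l)%N -> (a < l)%N -> (b < l)%N -> a != b ->
  edgeD l (swap_ends l a) (swap_ends l b) || edgeD l (swap_ends l b) (swap_ends l a)
  = edgeD l a b || edgeD l b a.
Proof.
case: l => [|[|[|[|m]]]] // _ al bl; rewrite /edgeD /swap_ends /= !eqSS.
have [->|na] := eqVneq a m.+3; [|have [->|na'] := eqVneq a m.+2];
  (have [->|nb] := eqVneq b m.+3; [|have [->|nb'] := eqVneq b m.+2]) => ab; lia.
Qed.

Lemma cartanD_swap l (i j : 'I_l) : (4 <= l)%N ->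
  cartanD (diagram_swap i) (diagram_swap j) = cartanD i j.
Proof.
move=> l4; have l2 : (2 <= l)%N by apply: leq_trans l4.
rewrite /cartanD (inj_eq (inv_inj (diagram_swapK l2))).
have [//|ij] := eqVneq i j; congr (if _ then _ else _).
by rewrite !val_diagram_swap // edgeD_swap.
Qed.

Lemma diagram_swap_node l (l4 : (4 <= l)%N) k : (k < l)%N ->
  diagram_swap (node l4 k) = node l4 (swap_ends l k).
Proof.
move=> kl; have l2 : (2 <= l)%N by apply: leq_trans l4.
apply: ord_inj; rewrite val_diagram_swap ?val_node // /swap_ends.
case: ifP => _; [|case: ifP => _ //]; clear -l4; lia.
Qed.

(** The exponent [l - 1] is the only repeated one. *)
Lemma middle_exponentD l (i : 'I_l) : ~~ odd l ->
  middle l i = (exponentD l i == l.-1).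
Proof. by rewrite /middle /exponentD => le; have := ltn_ord i; case: ifP; lia. Qed.

Lemma exponentD_inj l (i j : 'I_l) :
  ~~ odd l -> ~~ middle l i -> exponentD l j = exponentD l i -> j = i.
Proof.
move=> le im ij; apply: ord_inj; move: im ij (ltn_ord i) (ltn_ord j).
rewrite /middle /exponentD; do 2 case: ifP; lia.
Qed.

Lemma iter_bracket0 (F : fieldType) (n : nat) (x y : so F n) j k :
  iter j (bracket x) y = 0 -> (j <= k)%N -> iter k (bracket x) y = 0.
Proof.
move=> jy jk; rewrite -(subnK jk) iterD jy.
by elim: (_ - _)%N => //= i ->; rewrite bracket0r.
Qed.

(** The orthogonal subspace is the kernel of pairing with a basis. *)
Lemma form_orthogonal (F : fieldType) (n : nat) (B : {biscalar so F n})
    (U : {vspace so F n}) :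
  exists K : {vspace so F n}, forall x, x \in K <-> {in U, forall y, B x y = 0}.
Proof.
pose phi x : 'rV[F]_(\dim U) := \row_j B x (vbasis U)`_j.
have phi_lin : linear phi.
  by move=> a x y; apply/rowP => j; rewrite !mxE linearPl.
pose t : {linear so F n -> 'rV[F]_(\dim U)} :=
  HB.pack phi (GRing.isLinear.Build _ _ _ _ _ phi_lin).
exists (lker (linfun t)) => x; rewrite memv_ker lfunE /=; split=> [/eqP x0 y yU|x0].
  rewrite (coord_vbasis yU) linear_sum big1 // => j _.
  by have /rowP/(_ j) := x0; rewrite !mxE linearZ /= => ->; rewrite mulr0.
apply/eqP/rowP => j; rewrite !mxE x0 // vbasis_mem // mem_nth //.
by rewrite size_tuple.
Qed.

Section Principal.
Variables (F : numFieldType) (n l : nat).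
Hypothesis l_ge4 : (4 <= l)%N.
Hypothesis l_even : ~~ odd l.
Variable h : {vspace so F n}.
Hypothesis h_cartan : cartan_subalg h.
Variable B : {biscalar so F n}.
Hypothesis B_inv : invariant_form B.
Variable alpha : 'I_l -> hdual F h.
Hypothesis alpha_simple : simple_roots alpha.
Hypothesis form_simple : forall i j,
  dual_form B (alpha i) (alpha j) = (cartanD i j)%:~R.
Variables e f : 'I_l -> so F n.
Hypothesis e_root : forall i, root_vector (alpha i) (e i).
Hypothesis f_root : forall i, root_vector (- alpha i) (f i).
Hypothesis ef1 : forall i, B (e i) (f i) = 1.
Variable pos : seq (hdual F h).
Hypothesis pos_uniq : uniq pos.
Hypothesis posP : forall b, b \in pos <-> positive_root alpha b.
Variables (e0 f0 h0 : so F n) (c : 'I_l -> F).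
Hypothesis h0E : h0 = \sum_(b <- pos) coroot B b.
Hypothesis h0c : h0 = \sum_i c i *: coroot B (alpha i).
Hypothesis e0E : e0 = \sum_i e i.
Hypothesis f0E : f0 = \sum_i c i *: f i.
Variable s0 : {vspace so F n}.
Hypothesis s0E : s0 = <<[:: e0; f0; h0]>>%VS.
Variable sigma : 'End(so F n).
Hypothesis sigma_aut : lie_automorphism sigma.
Hypothesis sigma_order2 : order_two sigma.
Hypothesis sigma_e : forall i, sigma (e i) = e (diagram_swap i).
Hypothesis sigma_coroot : forall i,
  sigma (coroot B (alpha i)) = coroot B (alpha (diagram_swap i)).
Variable V : 'I_l -> {vspace so F n}.
Hypothesis V_decomp : principal_decomposition s0 V.

Variables g0 g1 : {vspace so F n}.
Hypothesis g0E : g0 = passmx.leigenspace sigma 1.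
Hypothesis g1E : g1 = passmx.leigenspace sigma (-1).
Let W := isotypic_W V.
Let W0 := (W :&: g0)%VS.
Let W1 := (W :&: g1)%VS.

Let H i := coroot B (alpha i).

Let sigmaK x : sigma (sigma x) = x.
Proof.
by case: sigma_order2 => /lfunP/(_ x); rewrite comp_lfunE id_lfunE.
Qed.

Let mem_eigen a x : (x \in passmx.leigenspace sigma a) = (sigma x == a *: x).
Proof.
by rewrite memv_ker add_lfunE opp_lfunE scale_lfunE id_lfunE subr_eq0.
Qed.

Let g0P x : (x \in g0) = (sigma x == x).
Proof. by rewrite g0E mem_eigen scale1r. Qed.

Let g1P x : (x \in g1) = (sigma x == - x).
Proof. by rewrite g1E mem_eigen scaleN1r. Qed.

Let sigma_bracket x y : sigma (bracket x y) = bracket (sigma x) (sigma y).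
Proof. by case: sigma_aut. Qed.

Let coroot_gen :=
  coroots_basis h_cartan B_inv alpha_simple (@cartanD_diag l) form_simple.

Let Hh i : H i \in h. Proof. exact: coroot_cartan. Qed.

Let cartan_ind (P : so F n -> Prop) :
  P 0 -> (forall x y, P x -> P y -> P (x + y)) ->
  (forall a i, P (a *: H i)) -> {in h, forall x, P x}.
Proof.
move=> P0 PD PH x xh.
have HB : basis_of h [tuple H i | i < l] by exact: coroot_gen.
rewrite (coord_basis HB xh); apply: big_ind => // i _.
by rewrite (nth_map i) ?size_enum_ord // nth_ord_enum.
Qed.

Let sigma_cartan : {in h, forall x, sigma x \in h}.
Proof.
apply: cartan_ind => [|x y xh yh|a i]; first by rewrite linear0 mem0v.
  by rewrite linearD memvD.
by rewrite linearZ /= sigma_coroot memvZ ?Hh.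
Qed.

Let h0_cartan : h0 \in h. Proof. exact: sum_coroots_cartan h0E. Qed.

Let h0_ss : ad_semisimple h0. Proof. exact: (cartan_semisimple h_cartan). Qed.

Let h0_e i : bracket h0 (e i) = 2 *: e i.
Proof.
exact: (h0_bracket_e h_cartan B_inv alpha_simple (@cartanD_diag l) form_simple
  e_root f_root ef1 pos_uniq posP h0E).
Qed.

Let h0_centralizer x : bracket h0 x = 0 -> x \in h.
Proof.
exact: (sum_coroots_centralizer h_cartan B_inv alpha_simple (@cartanD_diag l)
  form_simple e_root f_root ef1 pos_uniq posP h0E).
Qed.

Let tr : sl2_triple e0 f0 h0.
Proof.
rewrite e0E f0E.
exact: (principal_sl2 h_cartan B_inv alpha_simple (@cartanD_diag l)
  form_simple e_root f_root ef1 pos_uniq posP h0E).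
Qed.

Let swapK : involutive (@diagram_swap l).
Proof. by apply: diagram_swapK; apply: leq_trans l_ge4. Qed.

Let form_H i x : x \in h -> B (H i) x = alpha i (vsproj h x).
Proof.
move=> xh; rewrite /H (corootE (@cartanD_diag l) form_simple).
by rewrite -{1}(vsprojK xh) form_sharp.
Qed.

(** Both sides lie in [h] and act on every [e i] with eigenvalue 2, and an element of
    [h] is determined by its eigenvalues on the simple root vectors. *)
Let sigma_h0 : sigma h0 = h0.
Proof.
have Dh : sigma h0 - h0 \in h by rewrite memvB ?sigma_cartan.
apply/eqP; rewrite -subr_eq0; apply/eqP.
apply: (form_nondegenerate_cartan h_cartan B_inv Dh).
apply: cartan_ind => [|x y Dx Dy|a i]; first by rewrite linear0.
  by rewrite linearD /= Dx Dy addr0.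
rewrite linearZ /= (invariant_formC B_inv) form_H //.
have := e_root i (vsproj h (sigma h0 - h0)); rewrite vsprojK //.
rewrite bracketDl bracketNl h0_e -{1}(swapK i) -sigma_e -sigma_bracket h0_e.
rewrite linearZ /= sigma_e swapK subrr => /esym/eqP.
rewrite scaler_eq0 (negPf (simple_e_neq0 ef1 i)) orbF => /eqP ->.
by rewrite mulr0.
Qed.

Let sigma_e0 : sigma e0 = e0.
Proof.
rewrite e0E linear_sum [RHS](reindex_inj (inv_inj swapK)).
by apply: eq_bigr => i _ /=; rewrite sigma_e.
Qed.

(** The difference commutes with [e0] and has negative weight. *)
Let sigma_f0 : sigma f0 = f0.
Proof.
have [h0e h0f e0f] := tr; apply/eqP; rewrite -subr_eq0; apply: contraT => y0.
have hy : bracket h0 (sigma f0 - f0) = - 2 *: (sigma f0 - f0).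
  rewrite bracketBr -{1}sigma_h0 -sigma_bracket h0f linearZ /=.
  by rewrite [in RHS]scalerBr.
have ey : bracket e0 (sigma f0 - f0) = 0.
  by rewrite bracketBr -{1}sigma_e0 -sigma_bracket e0f sigma_h0 subrr.
have [m [/eqP]] := sl2_highest_weight tr y0 hy ey.
by rewrite eqr_oppLR -addr_eq0 -(natrD _ 2) pnatr_eq0.
Qed.

Let sigma_s0 : {in s0, forall x, sigma x = x}.
Proof.
move=> x xs; apply/eqP; rewrite -g0P; move: x xs; apply/subvP.
rewrite s0E; apply/span_subvP => x; rewrite !inE g0P.
by case/or3P=> /eqP ->; rewrite ?sigma_e0 ?sigma_f0 ?sigma_h0.
Qed.

Let sigma_com x y : x \in s0 -> sigma (bracket x y) = bracket x (sigma y).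
Proof. by move=> xs; rewrite sigma_bracket sigma_s0. Qed.

Let g_sub a : submodule s0 (passmx.leigenspace sigma a).
Proof.
move=> x y xs; rewrite !mem_eigen sigma_com // => /eqP ->.
by rewrite bracketZr.
Qed.

Let g0_sub : submodule s0 g0. Proof. by rewrite g0E; apply: g_sub. Qed.
Let g1_sub : submodule s0 g1. Proof. by rewrite g1E; apply: g_sub. Qed.

Let u := H (node l_ge4 (l - 2)) - H (node l_ge4 (l - 1)).

Let u_depth : [/\ bracket e0 u != 0, iter l.-1 (bracket e0) u != 0
                & iter l (bracket e0) u = 0].
Proof.
rewrite e0E; exact: (fork_depth l_ge4 h_cartan B_inv alpha_simple form_simple).
Qed.

Let u0 : u != 0.
Proof. by case: u_depth => nz _ _; apply: contraNneq nz => ->; rewrite bracket0r. Qed.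

Let uh : u \in h. Proof. by rewrite memvB ?Hh. Qed.

Let sigma_node k : (k < l)%N ->
  sigma (H (node l_ge4 k)) = H (node l_ge4 (swap_ends l k)).
Proof. by move=> kl; rewrite sigma_coroot diagram_swap_node. Qed.

Let lt_l1 : (l - 1 < l)%N. Proof. clear -l_ge4; lia. Qed.
Let lt_l2 : (l - 2 < l)%N. Proof. clear -l_ge4; lia. Qed.

Let sigma_u : sigma u = - u.
Proof.
rewrite /u linearB /= (sigma_node lt_l2) (sigma_node lt_l1) opprB.
by rewrite swap_ends1 swap_ends2 // (leq_trans _ l_ge4).
Qed.

(** The simple coroots are fixed by [sigma] except for the two that it exchanges. *)
Let cartan_g1 x : x \in h -> x \in g1 -> x \in <[u]>%VS.
Proof.
move=> xh; rewrite g1P => /eqP sx.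
have main : {in h, forall y, y - sigma y \in <[u]>%VS}.
  apply: cartan_ind => [|y z yu zu|a i].
  - by rewrite linear0 subrr mem0v.
  - by rewrite linearD /= opprD addrACA memvD.
  rewrite [sigma _]linearZ /= -scalerBr memvZ // -(nodeK l_ge4 i) sigma_node //.
  rewrite /swap_ends; case: eqP => [->|_].
    by rewrite -memvN opprB /u subn1 subn2 memv_line.
  case: eqP => [->|_]; last by rewrite subrr mem0v.
  by rewrite /u subn1 subn2 memv_line.
have := main x xh; rewrite sx opprK -mulr2n -scaler_nat => /(memvZ (2^-1)).
by rewrite scalerA mulVf ?scale1r ?pnatr_eq0.
Qed.

Let V_irr i : irreducible_submodule s0 (V i). Proof. by case: V_decomp. Qed.
Let V_dim i : \dim (V i) = (2 * exponentD l i + 1)%N. Proof. by case: V_decomp. Qed.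

(** The centralizer of [h0] is [h], so zero weight vectors lie in [h]; the weight
    space decomposition of [U] shows that there is only a line of them. *)
Let zero_weight (U : {vspace so F n}) k :
  irreducible_submodule s0 U -> \dim U = (2 * k + 1)%N ->
  exists z, [/\ z != 0, (U :&: h)%VS = <[z]>%VS, iter k (bracket e0) z != 0,
                iter k.+1 (bracket e0) z = 0
              & {in U, forall y, exists a y', y' \in U /\ y = a *: z + bracket h0 y'}].
Proof.
rewrite s0E => U_irr dimU.
have [z [zU h0z ez0 ez1 zP]] := irreducible_zero_weight tr h0_ss U_irr dimU.
exists z; split=> //.
  apply: contraNneq ez0 => ->; apply/eqP; elim: (k) => //= j ->.
  exact: bracket0r.
apply/vspaceP => y; rewrite memv_cap; apply/andP/vlineP => [[yU yh]|[a ->]].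
  have [a [y' [_ yE]]] := zP y yU; exists a.
  have : bracket h0 y = 0 by apply: (cartan_bracket h_cartan).
  rewrite yE bracketDr bracketZr h0z scaler0 add0r => /(semisimple_ker h0_ss) ->.
  by rewrite addr0.
by rewrite !memvZ //; apply: h0_centralizer.
Qed.

(** The zero weight vector of [U] is a multiple of [u], so the number of raising
    steps that it survives is known on both sides. *)
Let irreducible_g1_dim (U : {vspace so F n}) k :
  irreducible_submodule s0 U -> \dim U = (2 * k + 1)%N -> (U <= g1)%VS -> k = l.-1.
Proof.
move=> U_irr dimU Ug1; have [z [z0 Uh ez0 ez1 _]] := zero_weight U_irr dimU.
have : z \in (U :&: h)%VS by rewrite Uh memv_line.
rewrite memv_cap => /andP[/(subvP Ug1) zg1 zh].
have /vlineP[a zE] := cartan_g1 zh zg1.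
have a0 : a != 0 by apply: contraNneq z0 => a0; rewrite zE a0 scale0r.
have iterZ j : iter j (bracket e0) z = a *: iter j (bracket e0) u.
  by elim: j => [//|j IHj]; rewrite !iterS IHj bracketZr.
have [_ ul ul1] := u_depth.
have ez1' : iter k.+1 (bracket e0) u = 0.
  by apply/eqP; move/eqP: ez1; rewrite iterZ scaler_eq0 (negPf a0).
have k_lt : (k < l)%N.
  rewrite ltnNge; apply: contra ez0 => /(iter_bracket0 ul1).
  by rewrite iterZ => ->; rewrite scaler0.
have l_le : (l.-1 <= k)%N.
  by rewrite leqNgt; apply: contra ul => /(iter_bracket0 ez1') ->.
clear -k_lt l_le; lia.
Qed.

Let sigma_irr U :
  irreducible_submodule s0 U -> irreducible_submodule s0 (sigma @: U)%VS.
Proof.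
have sigma2 X : (sigma @: (sigma @: X))%VS = X.
  by rewrite -limg_comp; case: sigma_order2 => -> _; rewrite lim1g.
case=> U0 Us Ui; split.
- by move=> sU0; apply: U0; rewrite -[U]sigma2 sU0 limg0.
- by apply: submodule_img => // x y; apply: sigma_com.
move=> N Ns NU; have [||sN|sN] := Ui (sigma @: N)%VS.
- by apply: submodule_img => // x y; apply: sigma_com.
- by rewrite -[U]sigma2 limgS.
- by left; rewrite -[N]sigma2 sN limg0.
by right; rewrite -[N]sigma2 sN.
Qed.

(** * The automorphism on the principal decomposition *)

Let V_dir : directv (\sum_(i < l) V i). Proof. by case: V_decomp. Qed.
Let V_full : (\sum_(i < l) V i)%VS = fullv. Proof. by case: V_decomp. Qed.

Let sigma_inj : lker sigma == 0%VS.
Proof. by apply/lker0P; apply: can_inj sigmaK. Qed.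

(** [sigma] commutes with [s0], so it maps irreducible submodules to isomorphic ones. *)
Let sigma_V i :
  (sigma @: V i <= \sum_(j < l | exponentD l j == exponentD l i) V j)%VS.
Proof.
have := irreducible_sub_isotypic V_irr V_dir V_full (sigma_irr (V_irr i)).
congr (is_true (_ <= _)%VS); apply: eq_bigl => j.
rewrite limg_dim_eq ?(eqP sigma_inj) ?capv0 // !V_dim.
by rewrite eqn_add2r eqn_pmul2l.
Qed.

Let half_split x : x = 2^-1 *: (x + sigma x) + 2^-1 *: (x - sigma x).
Proof.
rewrite -scalerDr addrACA subrr addr0 -mulr2n -scaler_nat scalerA.
by rewrite mulVf ?scale1r ?pnatr_eq0.
Qed.

Let sym_g0 x : x + sigma x \in g0.
Proof. by rewrite g0P linearD /= sigmaK addrC. Qed.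

Let asym_g1 x : x - sigma x \in g1.
Proof. by rewrite g1P linearB /= sigmaK opprB. Qed.

Let g01_cap x : x \in g0 -> x \in g1 -> x = 0.
Proof.
rewrite g0P => /eqP sx x1.
have : sigma x == - x by rewrite -g1P.
rewrite sx -addr_eq0 => x2.
by move: x2; rewrite -mulr2n -scaler_nat scaler_eq0 pnatr_eq0 => /eqP.
Qed.

(** Being the only summand of its dimension, [V i] is stable under [sigma], which acts
    on it by a sign; the sign [-1] would force the exponent [l - 1]. *)
Lemma nonmiddle_sub_g0 (i : 'I_l) : ~~ middle l i -> (V i <= g0)%VS.
Proof.
move=> im; have sV : (sigma @: V i <= V i)%VS.
  have := sigma_V i; rewrite (big_pred1 i) // => j.
  apply/eqP/eqP => [|-> //]; exact: exponentD_inj.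
have [_ Vs Vi] := V_irr i.
have [||C0|<-] := Vi (V i :&: g0)%VS; last exact: capvSr.
- exact: submodule_cap.
- exact: capvSl.
case/negP: im; rewrite middle_exponentD //; apply/eqP.
apply: irreducible_g1_dim (V_irr i) (V_dim i) _; apply/subvP => x xV.
have : x + sigma x \in (V i :&: g0)%VS.
  by rewrite memv_cap sym_g0 memvD // (subvP sV) ?memv_img.
by rewrite C0 memv0 addr_eq0 g1P eq_sym -eqr_oppLR => /eqP ->.
Qed.

Let sigma_W : (sigma @: W <= W)%VS.
Proof.
rewrite /W /isotypic_W limg_sum; apply/subv_sumP => i im.
apply: subv_trans (sigma_V i) _; apply/subv_sumP => j /eqP ij.
by apply: (sumv_sup j); rewrite // middle_exponentD // ij -middle_exponentD.
Qed.

Lemma sigma_isotypic : (sigma @: W)%VS = W.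
Proof.
by apply/eqP; rewrite eqEdim sigma_W limg_dim_eq ?leqnn // (eqP sigma_inj) capv0.
Qed.

Let W_sigma x : x \in W -> sigma x \in W.
Proof. by move=> xW; rewrite (subvP sigma_W) ?memv_img. Qed.

Lemma isotypic_split : (W0 + W1)%VS = W.
Proof.
apply/eqP; rewrite eqEsubv subv_add !capvSl /=; apply/subvP => x xW.
rewrite [x]half_split memv_add // memvZ // memv_cap ?sym_g0 ?asym_g1 andbT.
  by rewrite memvD // W_sigma.
by rewrite memvB // W_sigma.
Qed.

Let W01_cap : (W0 :&: W1)%VS = 0%VS.
Proof.
apply/eqP; rewrite -subv0; apply/subvP => x; rewrite !memv_cap memv0.
by case/andP=> /andP[_ x0] /andP[_ x1]; apply/eqP/g01_cap.
Qed.

Lemma isotypic_split_direct : directv (W0 + W1).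
Proof. by apply/directv_addP. Qed.

Let half_lt : (l./2 < l)%N. Proof. by rewrite ltn_half_double; clear -l_ge4; lia. Qed.
Let half1_lt : (l./2.-1 < l)%N. Proof. exact: leq_ltn_trans (leq_pred _) half_lt. Qed.
Let m1 := node l_ge4 l./2.-1.
Let m2 := node l_ge4 l./2.

Let m12 : m1 != m2.
Proof. by rewrite node_eq //; clear -l_ge4; lia. Qed.

Let middleE (i : 'I_l) : middle l i = (i == m1) || (i == m2).
Proof. by rewrite /middle -[i in RHS](nodeK l_ge4) !node_eq. Qed.

Let sum_middle (U : 'I_l -> {vspace so F n}) :
  (\sum_(i < l | middle l i) U i)%VS = (U m1 + U m2)%VS.
Proof.
rewrite (bigD1 m1) /=; last by rewrite middleE eqxx.
rewrite (big_pred1 m2) // => i; rewrite middleE.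
by have [->|im1] := eqVneq i m1; rewrite /= ?andbT ?andbF ?(negPf m12).
Qed.

Let W_E : W = (V m1 + V m2)%VS. Proof. exact: sum_middle. Qed.

Let V_dim_middle (i : 'I_l) : middle l i -> \dim (V i) = (2 * l.-1 + 1)%N.
Proof. by rewrite V_dim middle_exponentD // => /eqP ->. Qed.

Let m1_mid : middle l m1. Proof. by rewrite middleE eqxx. Qed.
Let m2_mid : middle l m2. Proof. by rewrite middleE eqxx orbT. Qed.

Let V12_cap : (V m1 :&: V m2)%VS = 0%VS.
Proof.
apply/eqP; rewrite -subv0; have /directv_sumP/(_ m1 isT) <- := V_dir.
by apply: capvS => //; apply: (sumv_sup m2); rewrite // eq_sym.
Qed.

Let W_sub : submodule s0 W.
Proof.
by rewrite W_E; apply: submodule_add; [case: (V_irr m1) | case: (V_irr m2)].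
Qed.

Let W0_sub : submodule s0 W0. Proof. exact: submodule_cap W_sub g0_sub. Qed.
Let W1_sub : submodule s0 W1. Proof. exact: submodule_cap W_sub g1_sub. Qed.

Let dim_sub_W N : submodule s0 N -> (N <= W)%VS ->
  \dim N \in [:: 0; 2 * l.-1 + 1; 2 * (2 * l.-1 + 1)]%N.
Proof.
by rewrite W_E; apply: dim_submodule_sum2 => //; apply: V_dim_middle.
Qed.

(** The components of [u] in the other summands are fixed by [sigma]. *)
Let u_W1 : u \in W1.
Proof.
rewrite memv_cap g1P sigma_u eqxx andbT.
have uE : u = 2^-1 *: (u - sigma u).
  by rewrite {1}[u]half_split sigma_u subrr scaler0 add0r.
rewrite uE memvZ //; have : u \in fullv by apply: memvf.
rewrite -V_full => /memv_sumP[v vV ->].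
rewrite linear_sum -sumrB (bigID (fun i : 'I_l => middle l i)) /=.
rewrite [X in _ + X]big1 ?addr0 => [|i im]; last first.
  apply/eqP; rewrite subr_eq0 eq_sym -g0P.
  by rewrite (subvP (nonmiddle_sub_g0 im)) ?vV.
apply: rpred_sum => i im; have vW : v i \in W.
  by apply: subvP (vV i isT); apply: (sumv_sup i).
by rewrite memvB // W_sigma.
Qed.

(** Otherwise the zero weight vectors of the two summands of [W] would both lie on
    the line of [u]. *)
Let W0_neq0 : W0 != 0%VS.
Proof.
apply/eqP => W00; have line (i : 'I_l) : middle l i ->
    exists z, [/\ z \in V i, z != 0 & z \in <[u]>%VS].
  move=> im; have [z [z0 Vh _ _ _]] := zero_weight (V_irr i) (V_dim i).
  have : z \in (V i :&: h)%VS by rewrite Vh memv_line.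
  rewrite memv_cap => /andP[zV zh]; exists z; split=> //; apply: cartan_g1 => //.
  have zW : z \in W by apply: subvP zV; apply: (sumv_sup i).
  have : z + sigma z \in W0 by rewrite memv_cap sym_g0 memvD // W_sigma.
  by rewrite W00 memv0 addr_eq0 g1P eq_sym -eqr_oppLR => /eqP ->.
have [z1 [z1V z10 /vlineP[a1 z1E]]] := line _ m1_mid.
have [z2 [z2V z20 /vlineP[a2 z2E]]] := line _ m2_mid.
have a1_0 : a1 != 0 by apply: contraNneq z10 => a0; rewrite z1E a0 scale0r.
have : z2 \in (V m1 :&: V m2)%VS.
  rewrite memv_cap z2V andbT z2E.
  have -> : u = a1^-1 *: z1 by rewrite z1E scalerA mulVf ?scale1r.
  by rewrite !memvZ.
by rewrite V12_cap memv0 (negPf z20).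
Qed.

(** Both are nonzero submodules whose dimensions are multiples of that of one
    irreducible summand and add up to twice it. *)
Let dim_W01 : \dim W0 = (2 * l.-1 + 1)%N /\ \dim W1 = (2 * l.-1 + 1)%N.
Proof.
have d0 := dim_sub_W W0_sub (capvSl _ _).
have d1 := dim_sub_W W1_sub (capvSl _ _).
have nz0 : \dim W0 != 0%N by rewrite dimv_eq0.
have nz1 : \dim W1 != 0%N.
  rewrite dimv_eq0; apply: contraNneq u0 => W10.
  by have := u_W1; rewrite W10 memv0.
have := dimv_disjoint_sum W01_cap; rewrite isotypic_split W_E.
rewrite (dimv_disjoint_sum V12_cap) !V_dim_middle //.
move: d0 d1 nz0 nz1; rewrite !inE; move: (\dim W0) (\dim W1) (2 * l.-1 + 1)%N => a b d.
clear; lia.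
Qed.

Let sub_W_irr N : submodule s0 N -> (N <= W)%VS -> \dim N = (2 * l.-1 + 1)%N ->
  irreducible_submodule s0 N.
Proof.
move=> Ns NW dimN; split=> //; first by move=> N0; rewrite N0 dimv0 addn1 in dimN.
move=> N' Ns' NN'; have := dim_sub_W Ns' (subv_trans NN' NW).
have := dimvS NN'; rewrite dimN => le_d; rewrite !inE => /or3P[/eqP d|/eqP d|/eqP d].
- by left; apply/eqP; rewrite -dimv_eq0 d.
- by right; apply/eqP; rewrite eqEdim NN' dimN d leqnn.
by move: le_d; rewrite d; clear; lia.
Qed.

Lemma isotypic_sym_irreducible : irreducible_submodule s0 W0.
Proof. by apply: sub_W_irr; rewrite ?capvSl //; case: dim_W01. Qed.

Lemma isotypic_asym_irreducible : irreducible_submodule s0 W1.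
Proof. by apply: sub_W_irr; rewrite ?capvSl //; case: dim_W01. Qed.

Let form_sigma_cartan : {in h &, forall x y, B (sigma x) (sigma y) = B x y}.
Proof.
move=> x y xh yh; move: x xh.
apply: cartan_ind => [|x x' Bx Bx'|a i].
- by rewrite [sigma 0]linear0 !linear0l.
- by rewrite [sigma (x + x')]linearD !linearDl /= Bx Bx'.
rewrite [sigma _]linearZ /= sigma_coroot -/(H _) [LHS]linearZl_LR [RHS]linearZl_LR /=.
congr (_ * _); move: y yh.
apply: cartan_ind => [|y y' By By'|b j].
- by rewrite [sigma 0]linear0 [LHS]linear0 [RHS]linear0.
- by rewrite [sigma (y + y')]linearD [LHS]linearD [RHS]linearD /= By By'.
rewrite [sigma _]linearZ /= sigma_coroot -/(H _) [LHS]linearZ [RHS]linearZ /=; congr (_ * _).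
rewrite /H !(corootE (@cartanD_diag l) form_simple).
by rewrite -!/(dual_form B _ _) !form_simple cartanD_swap.
Qed.

Let h0_s0 : h0 \in s0.
Proof. by rewrite s0E memv_span // !inE eqxx !orbT. Qed.

(** What is orthogonal to [W1] in [W0] is a submodule, so it suffices to find one
    nonzero element in it. The zero weight vector of [W0] serves: it is orthogonal
    to the other weight spaces by invariance, and to the zero weight space of
    [W1] because the form on the Cartan subalgebra is [sigma]-invariant. *)
Lemma isotypic_orthogonal x y : x \in W0 -> y \in W1 -> B x y = 0.
Proof.
have [dim0 dim1] := dim_W01.
have [w0 [w00 W0h _ _ _]] := zero_weight isotypic_sym_irreducible dim0.
have [w1 [w10 W1h _ _ w1P]] := zero_weight isotypic_asym_irreducible dim1.
have [[w0W0 w0h] [w1W1 w1h]] : (w0 \in W0 /\ w0 \in h) /\ (w1 \in W1 /\ w1 \in h).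
  by split; apply/memv_capP; rewrite ?W0h ?W1h memv_line.
have sw0 : sigma w0 = w0 by apply/eqP; rewrite -g0P; case/memv_capP: w0W0.
have sw1 : sigma w1 = - w1 by apply/eqP; rewrite -g1P; case/memv_capP: w1W1.
have w01 : B w0 w1 = 0.
  have /eqP := form_sigma_cartan w0h w1h; rewrite sw0 sw1 linearN /= eq_sym.
  by rewrite -addr_eq0 -mulr2n mulrn_eq0 => /eqP.
have [K KP] := form_orthogonal B W1.
have [_ _ W0_irr] := isotypic_sym_irreducible.
have [||K0|<-] := W0_irr (W0 :&: K)%VS.
- apply: submodule_cap => // t v ts /KP vK; apply/KP => w wW1.
  by rewrite bracketC linearNl /= (form_bracket B_inv) vK ?oppr0 // W1_sub.
- exact: capvSl.
- case/eqP: w00; apply/eqP; rewrite -memv0 -K0; apply/memv_capP; split=> //.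
  apply/KP => v /w1P[a [v' [_ ->]]].
  rewrite linearD linearZ /= w01 mulr0 add0r -(form_bracket B_inv).
  by rewrite (cartan_bracket h_cartan) ?linear0l.
by move=> /memv_capP[_ /KP xK] /xK.
Qed.

Let cartan_lines : exists w0 w1, [/\ w0 != 0, w1 != 0, (W0 :&: h)%VS = <[w0]>%VS,
  (W1 :&: h)%VS = <[w1]>%VS & (W :&: h)%VS = (<[w0]> + <[w1]>)%VS].
Proof.
have [dim0 dim1] := dim_W01.
have [w0 [w00 W0h _ _ _]] := zero_weight isotypic_sym_irreducible dim0.
have [w1 [w10 W1h _ _ _]] := zero_weight isotypic_asym_irreducible dim1.
exists w0, w1; split=> //; rewrite -W0h -W1h; apply/eqP; rewrite eqEsubv.
rewrite subv_add !subv_cap !capvSr !(subv_trans (capvSl _ _) (capvSl _ _)) !andbT.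
apply/subvP => x; rewrite memv_cap => /andP[xW xh].
rewrite [x]half_split memv_add // memvZ // !memv_cap ?sym_g0 ?asym_g1 andbT.
  by rewrite !memvD ?W_sigma ?sigma_cartan.
by rewrite !memvB ?W_sigma ?sigma_cartan.
Qed.

(** The components of a vector of weight zero have weight zero. *)
Let cartan_components : (h <= \sum_(i < l) (V i :&: h))%VS.
Proof.
apply/subvP => x xh; have : x \in fullv by apply: memvf.
rewrite -V_full => /memv_sumP[v vV xE].
rewrite xE; apply: memv_sumr => i _; rewrite memv_cap vV //=.
apply: h0_centralizer; have /directv_sum_independent := V_dir.
move=> /(_ (fun j => bracket h0 (v j))); apply=> // [j _|].
  by have [_ Vs _] := V_irr j; rewrite Vs // vV.
by rewrite -linear_sum -xE /= (cartan_bracket h_cartan).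
Qed.

Let dim_h : \dim h = l.
Proof.
have HB : basis_of h [tuple H i | i < l] by exact: coroot_gen.
exact: size_basis HB.
Qed.

Lemma eigen_principal_basis_exists :
  exists b : 'I_l -> so F n, principal_basis V h b /\ eigenvectors sigma b.
Proof.
have [w0 [w1 [w00 w10 W0h W1h Wh]]] := cartan_lines.
have /fin_all_exists[z zP] : forall i : 'I_l, exists z, (V i :&: h)%VS = <[z]>%VS.
  by move=> i; have [z [_ Vh _ _ _]] := zero_weight (V_irr i) (V_dim i); exists z.
pose b i := if i == m1 then w0 else if i == m2 then w1 else z i.
have b1 : b m1 = w0 by rewrite /b eqxx.
have b2 : b m2 = w1 by rewrite /b eqxx eq_sym (negPf m12).
have bz (i : 'I_l) : ~~ middle l i -> b i = z i.
  by rewrite middleE /b; case: eqP => //; case: eqP.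
have bW : (\sum_(i < l | middle l i) <[b i]>)%VS = (W :&: h)%VS.
  by rewrite sum_middle b1 b2 Wh.
have b_basis : basis_of h [seq b i | i <- enum 'I_l].
  rewrite basisEdim size_map size_enum_ord dim_h leqnn andbT.
  apply: subv_trans cartan_components _.
  have bS i : (<[b i]> <= <<[seq b i | i <- enum 'I_l]>>)%VS.
    by rewrite -memvE memv_span // map_f // mem_enum.
  apply/subv_sumP => i _; case: (boolP (middle l i)) => im; last by rewrite zP -bz.
  apply: (@subv_trans _ _ (W :&: h)%VS).
    by apply: capvS => //; apply: (sumv_sup i).
  by rewrite -bW; apply/subv_sumP => j _.
exists b; split; first by split=> // i im; rewrite zP bz.
move=> i; case: (boolP (middle l i)) => im; last first.
  exists 1; rewrite -g0E; apply: subvP (nonmiddle_sub_g0 im) _ _.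
  by have := memv_line (z i); rewrite -zP memv_cap bz // => /andP[].
move: im; rewrite middleE => /orP[/eqP->|/eqP->].
  exists 1; rewrite -g0E b1; have := memv_line w0.
  by rewrite -W0h !memv_cap => /andP[/andP[]].
exists (-1); rewrite -g1E b2; have := memv_line w1.
by rewrite -W1h !memv_cap => /andP[/andP[]].
Qed.

(** On [W :&: h] the eigenspaces of [sigma] are the lines [W0 :&: h] and [W1 :&: h],
    so the only freedom besides scalars is which middle index gets which line. *)
Lemma eigen_principal_basis_unique (b b' : 'I_l -> so F n) :
  principal_basis V h b -> eigenvectors sigma b ->
  principal_basis V h b' -> eigenvectors sigma b' ->
  exists (p : {perm 'I_l}) (d : 'I_l -> F),
    (forall i : 'I_l, ~~ middle l i -> p i = i) /\
    (forall i, d i != 0 /\ b' i = d i *: b (p i)).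
Proof.
have [w0 [w1 [w00 w10 W0h W1h Wh]]] := cartan_lines.
pose w (s : bool) := if s then w1 else w0.
have w_line s t : w t \in <[w s]>%VS -> t = s.
  have cap0 x : x \in <[w0]>%VS -> x \in <[w1]>%VS -> x = 0.
    rewrite -W0h -W1h !memv_cap => /andP[/andP[_ x0] _] /andP[/andP[_ x1] _].
    exact: g01_cap.
  by case: s; case: t => //= wx; [case/eqP: w00 | case/eqP: w10]; apply: cap0 => //;
    apply: memv_line.
have oriented a : principal_basis V h a -> eigenvectors sigma a ->
    exists s, a m1 \in <[w s]>%VS /\ a m2 \in <[w (~~ s)]>%VS.
  move=> [a_basis _ aW] a_eig; rewrite sum_middle in aW.
  have in_line (i : 'I_l) : middle l i -> exists s, a i \in <[w s]>%VS.
    move=> im; have a0 : a i != 0.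
      by apply: (basis_not0 a_basis); rewrite map_f // mem_enum.
    have : a i \in (W :&: h)%VS.
      rewrite -aW; move: im; rewrite middleE => /orP[]/eqP->.
        by rewrite memvE addvSl.
      by rewrite memvE addvSr.
    rewrite memv_cap => /andP[aiW aih]; have [k] := a_eig i.
    rewrite mem_eigen => /eqP sa.
    have : k ^+ 2 == 1.
      rewrite -subr_eq0; have /eqP := sigmaK (a i).
      rewrite sa linearZ /= sa scalerA -expr2 -subr_eq0 -{2}[a i]scale1r.
      by rewrite -scalerBl scaler_eq0 (negPf a0) orbF.
    rewrite sqrf_eq1 => /orP[]/eqP kE.
      by exists false; rewrite /= -W0h !memv_cap aiW aih g0P sa kE scale1r eqxx.
    by exists true; rewrite /= -W1h !memv_cap aiW aih g1P sa kE scaleN1r eqxx.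
  have [s1 a1] := in_line _ m1_mid; have [s2 a2] := in_line _ m2_mid.
  exists s1; split=> //; suff -> : ~~ s1 = s2 by [].
  apply/eqP; apply: contraT => s12; have s21 : s2 = s1 by case: (s1) (s2) s12 => [] [].
  have : w (~~ s1) \in (W :&: h)%VS.
    by rewrite Wh; case: (s1) => /=; rewrite memvE ?addvSl ?addvSr.
  rewrite -aW => wa; have : w (~~ s1) \in <[w s1]>%VS.
    by apply: subvP wa; rewrite subv_add -!memvE a1 -s21 a2.
  by move/w_line; case: (s1).
have prop (x y t : so F n) : x \in <[t]>%VS -> y \in <[t]>%VS -> x != 0 -> y != 0 ->
    exists k : F, k != 0 /\ y = k *: x.
  move=> /vlineP[k1 ->] /vlineP[k2 ->]; rewrite !scaler_eq0 !negb_or.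
  move=> /andP[k10 _] /andP[k20 _]; exists (k2 / k1).
  by rewrite mulf_neq0 ?invr_eq0 // scalerA divfK.
move=> bP b_eig b'P b'_eig.
have [s [bs1 bs2]] := oriented b bP b_eig.
have [s' [bs'1 bs'2]] := oriented b' b'P b'_eig.
have nz a i : principal_basis V h a -> a i != 0.
  by case=> a_basis _ _; apply: (basis_not0 a_basis); rewrite map_f // mem_enum.
pose p : {perm 'I_l} := if s == s' then 1%g else tperm m1 m2.
have p_fix (i : 'I_l) : ~~ middle l i -> p i = i.
  rewrite middleE negb_or => /andP[i1 i2]; rewrite /p; case: ifP => _.
    by rewrite perm1.
  by rewrite tpermD // eq_sym.
have /fin_all_exists[d dP] : forall i, exists k : F,
    k != 0 /\ b' i = k *: b (p i).
  move=> i; case: (boolP (middle l i)) => im; last first.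
    rewrite p_fix //; have [[_ bV _] [_ b'V _]] := (bP, b'P).
    by apply: (prop _ _ (b i)); rewrite ?nz // ?memv_line // bV // -b'V // memv_line.
  move: im; rewrite middleE => /orP[]/eqP->; rewrite /p; case: eqP => ss'.
  - by rewrite perm1; apply: (prop _ _ (w s)); rewrite ?nz // ss'.
  - rewrite tpermL; apply: (prop _ _ (w (~~ s))); rewrite ?nz //.
    by have -> : ~~ s = s' by case: (s) (s') ss' => [] [].
  - by rewrite perm1; apply: (prop _ _ (w (~~ s))); rewrite ?nz // ss'.
  rewrite tpermR; apply: (prop _ _ (w s)); rewrite ?nz //.
  by have -> : s = ~~ s' by case: (s) (s') ss' => [] [].
by exists p, d.
Qed.

Lemma principal_decomposition_sigma :
  [/\ forall i : 'I_l, ~~ middle l i -> (V i <= g0)%VS,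
      (sigma @: W)%VS = W,
      [/\ (W0 + W1)%VS = W, directv (W0 + W1),
          irreducible_submodule s0 W0, irreducible_submodule s0 W1
        & forall x y, x \in W0 -> y \in W1 -> B x y = 0]
    & (exists b : 'I_l -> so F n,
          principal_basis V h b /\ eigenvectors sigma b) /\
      (forall b b' : 'I_l -> so F n,
          principal_basis V h b -> eigenvectors sigma b ->
          principal_basis V h b' -> eigenvectors sigma b' ->
          exists (p : {perm 'I_l}) (d : 'I_l -> F),
            (forall i : 'I_l, ~~ middle l i -> p i = i) /\
            (forall i, d i != 0 /\ b' i = d i *: b (p i)))].
Proof.
split; [exact: nonmiddle_sub_g0 | exact: sigma_isotypic | | split].
- split; [exact: isotypic_split | exact: isotypic_split_direct
    | exact: isotypic_sym_irreducible | exact: isotypic_asym_irreducible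
    | exact: isotypic_orthogonal].
- exact: eigen_principal_basis_exists.
exact: eigen_principal_basis_unique.
Qed.

End Principal.

Theorem theorem5p1 (R : realType) (l : nat) (l_ge4 : (4 <= l)%N)
  (l_even : ~~ odd l)
  (h : {vspace so R[i] (2 * l)}) (h_cartan : cartan_subalg h)
  (B : {biscalar so R[i] (2 * l)}) (B_inv : invariant_form B)
  (alpha : 'I_l -> hdual R[i] h)
  (alpha_D : simple_roots_D B alpha)
  (B_normalized : forall i, dual_form B (alpha i) (alpha i) = 2)
  (e f : 'I_l -> so R[i] (2 * l))
  (e_root : forall i, root_vector (alpha i) (e i))
  (f_root : forall i, root_vector (- alpha i) (f i))
  (ef1 : forall i, B (e i) (f i) = 1)
  (pos : seq (hdual R[i] h)) (pos_uniq : uniq pos)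
  (posP : forall b, b \in pos <-> positive_root alpha b)
  (e0 f0 h0 : so R[i] (2 * l)) (c : 'I_l -> R[i])
  (h0E : h0 = \sum_(b <- pos) coroot B b)
  (h0c : h0 = \sum_i c i *: coroot B (alpha i))
  (e0E : e0 = \sum_i e i)
  (f0E : f0 = \sum_i c i *: f i)
  (s0 : {vspace so R[i] (2 * l)}) (s0E : s0 = <<[:: e0; f0; h0]>>%VS)
  (sigma : 'End(so R[i] (2 * l)))
  (sigma_aut : lie_automorphism sigma)
  (sigma_order2 : order_two sigma)
  (sigma_e : forall i, sigma (e i) = e (diagram_swap i))
  (sigma_f : forall i, sigma (f i) = f (diagram_swap i))
  (sigma_coroot : forall i, sigma (coroot B (alpha i)) =
                            coroot B (alpha (diagram_swap i)))
  (V : 'I_l -> {vspace so R[i] (2 * l)})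
  (V_decomp : principal_decomposition s0 V) :
  let g0 := passmx.leigenspace sigma 1 in
  let g1 := passmx.leigenspace sigma (-1) in
  let W := isotypic_W V in
  let W0 := (W :&: g0)%VS in
  let W1 := (W :&: g1)%VS in
  [/\ (* (a) *)
      forall i : 'I_l, ~~ middle l i -> (V i <= g0)%VS,
      (* (b) *)
      (sigma @: W)%VS = W,
      (* (c) *)
      [/\ (W0 + W1)%VS = W, directv (W0 + W1),
          irreducible_submodule s0 W0, irreducible_submodule s0 W1
        & forall x y, x \in W0 -> y \in W1 -> B x y = 0]
    & (* existence and uniqueness of the sigma-adapted principal basis *)
      (exists b : 'I_l -> so R[i] (2 * l),
          principal_basis V h b /\ eigenvectors sigma b) /\
      (forall b b' : 'I_l -> so R[i] (2 * l),
          principal_basis V h b -> eigenvectors sigma b ->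
          principal_basis V h b' -> eigenvectors sigma b' ->
          exists (p : {perm 'I_l}) (d : 'I_l -> R[i]),
            (forall i : 'I_l, ~~ middle l i -> p i = i) /\
            (forall i, d i != 0 /\ b' i = d i *: b (p i)))].
Proof.
case: alpha_D => alpha_simple cartanE g0 g1 W W0 W1.
have form_simple i j : dual_form B (alpha i) (alpha j) = (cartanD i j)%:~R.
  by rewrite -cartanE B_normalized mulrAC divff ?mul1r // pnatr_eq0.
exact: (principal_decomposition_sigma l_ge4 l_even h_cartan B_inv alpha_simple
  form_simple e_root f_root ef1 pos_uniq posP h0E h0c e0E f0E s0E sigma_aut
  sigma_order2 sigma_e sigma_coroot V_decomp (erefl g0) (erefl g1)).
Qed.
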